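(* Let $n$ be an odd prime. Then there exists a cellular biembedding of $K_{2\times 2n^2}$ into an orientable surface such that every face has length $4n$, $4n^2$ or $4n^3$.
   Context: $K_{q\times r}$ denotes the complete multipartite graph with $q$ parts each of size $r$. An embedding of a graph $\Gamma$ (as a $1$-dimensional simplicial complex) in a surface $\Sigma$ is a continuous injective map $\phi:\Gamma\to\Sigma$; the connected components of $\Sigma\setminus\phi(\Gamma)$ are its faces; the embedding is cellular if every face is homeomorphic to an open disc. A circuit decomposition of a graph is a set of circuits (closed trails, without repeated edges but possibly with repeated vertices) whose edge-sets partition the edge-set. A biembedding of two circuit decompositions $\mathcal{D},\mathcal{D}'$ of a simple graph $\Gamma$ is a face $2$-colorable embedding of $\Gamma$ in which (the boundaries of the faces of) one color class are the circuits of $\mathcal{D}$ and those of the other color class are the circuits of $\mathcal{D}'$. A biembedding of $\Gamma$ means a biembedding of some two circuit decompositions of $\Gamma$. The length of a face is the number of edges of its boundary circuit. *)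

(* Defs.v *)
From mathcomp Require Import all_boot all_order all_algebra.
From mathcomp Require Import all_classical all_reals all_analysis.
Import Order.TTheory GRing.Theory Num.Theory numFieldNormedType.Exports.

Set Implicit Arguments.
Unset Strict Implicit.
Unset Printing Implicit Defensive.

Local Open Scope classical_set_scope.
Local Open Scope ring_scope.

(** * Graphs and circuits.  A simple graph is a symmetric irreflexive relation
    on a finite type of vertices. *)

(* K_{q x r}: the parts are the fibres of the first projection. *)
Definition complete_multipartite (q r : nat) : rel ('I_q * 'I_r) :=
  fun u v => u.1 != v.1.

Section Circuits.
Variables (V : finType) (e : rel V).

Definition edge_set : {set {set V}} :=
  [set [set u.1; u.2]%SET | u : V * V & e u.1 u.2]%SET.

(* A closed walk is given by the cyclic sequence of its vertices; its steps
   are the pairs of cyclically consecutive vertices. *)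
Definition steps (c : seq V) : seq (V * V) := zip c (rot 1 c).

Definition walk_edges (c : seq V) : seq {set V} :=
  [seq [set a.1; a.2]%SET | a <- steps c].

Definition circuit (c : seq V) : bool :=
  [&& c != [::], cycle e c & uniq (walk_edges c)].

(* Each circuit of the decomposition is represented by one of its vertex
   sequences (starting point and direction are immaterial). *)
Definition circuit_decomposition (D : seq (seq V)) : Prop :=
  all circuit D /\ perm_eq (flatten [seq walk_edges c | c <- D]) (enum edge_set).

End Circuits.

(** * Surfaces *)

(* [f] restricts to a homeomorphism from [A] onto [B], with inverse [g]; the
   values of [f] outside [A] and of [g] outside [B] are irrelevant. *)
Definition homeomorphism (T U : topologicalType) (A : set T) (B : set U)
    (f : T -> U) (g : U -> T) : Prop :=
  [/\ f @` A = B, (forall x, A x -> g (f x) = x),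
      {within A, continuous f} & {within B, continuous g}].

Definition homeomorphic (T U : topologicalType) (A : set T) (B : set U) : Prop :=
  exists f g, homeomorphism A B f g.

Section Surfaces.
Variable R : realType.

Definition open_disc : set (R * R) := [set p | p.1 ^+ 2 + p.2 ^+ 2 < 1].

Definition closed_disc : set (R * R) := [set p | p.1 ^+ 2 + p.2 ^+ 2 <= 1].

(* The point with polar coordinates [(r, t)] about [p]. *)
Definition polar (p : R * R) (r t : R) : R * R :=
  (p.1 + r * cos t, p.2 + r * sin t).

(* The path [gamma], defined on [0, 2 pi], has winding number +1 about [p]:
   it has a continuous argument [theta] about [p], which increases by 2 pi. *)
Definition winds_once (gamma : R -> R * R) (p : R * R) : Prop :=
  exists theta rho : R -> R,
    [/\ {within `[0, 2 * pi], continuous theta},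
        (forall t, 0 <= t <= 2 * pi -> 0 < rho t),
        (forall t, 0 <= t <= 2 * pi -> gamma t = polar p (rho t) (theta t)) &
        theta (2 * pi) = theta 0 + 2 * pi].

(* [f], assumed to be a homeomorphism from the open set [A] onto an open subset
   of the plane, has local degree +1 at each point of [A].  The winding number
   is the same for all discs about [p] that are contained in [A]. *)
Definition orientation_preserving (A : set (R * R)) (f : R * R -> R * R) : Prop :=
  forall p, A p -> exists r : R,
    [/\ 0 < r, (forall s t, 0 <= s <= r -> A (polar p s t)) &
        winds_once (fun t => f (polar p r t)) (f p)].

Section Manifold.
Variable S : topologicalType.

Definition chart (U : set S) (W : set (R * R)) (f : S -> R * R) (g : R * R -> S) :
    Prop :=
  [/\ open U, open W & homeomorphism U W f g].

(* Connected compact 2-manifolds without boundary; second countability follows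
   from compactness. *)
Definition closed_surface : Prop :=
  [/\ hausdorff_space S, compact [set: S], connected [set: S] &
      forall x : S, exists U W f g, U x /\ chart U W f g].

(* There is an atlas all of whose transition maps preserve orientation. *)
Definition orientable : Prop :=
  exists (I : Type) (U : I -> set S) (W : I -> set (R * R))
         (f : I -> S -> R * R) (g : I -> R * R -> S),
    [/\ (forall i, chart (U i) (W i) (f i) (g i)),
        (forall x, exists i, U i x) &
        forall i j, orientation_preserving (f i @` (U i `&` U j)) (f j \o g i)].

End Manifold.
End Surfaces.

(** * Graphs embedded in surfaces *)

Section Embeddings.
Variables (R : realType) (V : finType) (e : rel V).

(* The point at parameter [s] of the segment from [u] to [v], in barycentric
   coordinates. *)
Definition segment_point (u v : V) (s : R) : {ptws V -> R} :=
  fun w => (1 - s) * (w == u)%:R + s * (w == v)%:R.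

Definition segment (u v : V) : set {ptws V -> R} :=
  [set segment_point u v s | s in `[0, 1]].

(* The graph as a 1-dimensional simplicial complex in R^V; the degenerate
   segments [u = v] are the vertices. *)
Definition realization : set {ptws V -> R} :=
  [set x | exists u v, ((u == v) || e u v) /\ segment u v x].

Variable S : topologicalType.
Implicit Types (phi : {ptws V -> R} -> S) (F : set S) (c : seq V).

Definition embedding phi : Prop :=
  {within realization, continuous phi} /\
  (forall x y, realization x -> realization y -> phi x = phi y -> x = y).

Definition face phi F : Prop :=
  exists x, (~` (phi @` realization)) x /\
            F = connected_component (~` (phi @` realization)) x.

Definition cellular phi : Prop :=
  forall F, face phi F -> homeomorphic F (@open_disc R).

(* The face [F] is bounded by the closed walk [c]: it is attached to the graph
   by a map [h] from the closed disc that is a homeomorphism from the open disc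
   onto [F] and whose restriction to the unit circle, cut into [size c] equal
   arcs, runs through the successive edges of [c]. *)
Definition bounded_by phi F c : Prop :=
  exists (h : R * R -> S) (g : S -> R * R),
    [/\ {within @closed_disc R, continuous h},
        homeomorphism (@open_disc R) F h g &
        forall (i : nat) (u v : V) (s : R),
          onth (steps c) i = Some (u, v) -> 0 <= s <= 1 ->
          h (polar (0, 0) 1 (2 * pi * (i%:R + s) / (size c)%:R)) =
          phi (segment_point u v s)].

Definition face_length phi F (k : nat) : Prop :=
  exists c, [/\ circuit e c, bounded_by phi F c & size c = k].

(* Distinct faces sharing an edge have distinct colors. *)
Definition proper_face_coloring phi (col : set S -> bool) : Prop :=
  forall F G u v, face phi F -> face phi G -> F <> G -> e u v ->
    phi @` segment u v `<=` closure F `&` closure G -> col F != col G.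

(* The boundaries of the faces of color [b] are exactly the circuits of [D]. *)
Definition color_class_bounds phi (col : set S -> bool) (b : bool)
    (D : seq (seq V)) : Prop :=
  (forall F, face phi F -> col F = b -> exists c, c \in D /\ bounded_by phi F c) /\
  (forall c, c \in D -> exists F, [/\ face phi F, col F = b & bounded_by phi F c]).

Definition biembedding_of (D D' : seq (seq V)) phi : Prop :=
  embedding phi /\
  exists col, [/\ proper_face_coloring phi col,
                  color_class_bounds phi col true D &
                  color_class_bounds phi col false D'].

Definition biembedding phi : Prop :=
  exists D D', [/\ circuit_decomposition e D, circuit_decomposition e D' &
                   biembedding_of D D' phi].

End Embeddings.

(* Main.v *)
(** Let N = n^2 and m = 2N.  The surface is the Fermat curve x^m + y^m + z^m = 0
    in the complex projective plane, and the graph is the preimage of [0, 1]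
    under the map -(x / z)^m onto the Riemann sphere: over its interior there are
    m^2 arcs, and over each end m points.  The preimage of the complement of
    [0, 1] consists of m open discs, on each of which the map is d |-> d^m
    followed by the conformal map w |-> (1 + w)^2 / 4w of the disc onto the
    complement; their boundaries are Hamiltonian cycles, of length 2m = 4 n^2.
    The graph is the locus where y = 0 or (x / y)^N is real, and the sign of the
    imaginary part of (x / y)^N is the face coloring.
    Orientability holds because the coordinate changes of the curve are
    holomorphic with nonzero derivative. *)

Require Import Defs.
From HB Require Import structures.
From mathcomp Require Import all_boot all_order all_algebra.
From mathcomp Require Import all_classical all_reals all_analysis.
From mathcomp Require Import complex.
From mathcomp Require Import ring lra zify.
Import Order.TTheory GRing.Theory Num.Theory numFieldNormedType.Exports.

Set Implicit Arguments.
Unset Strict Implicit.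
Unset Printing Implicit Defensive.

Local Open Scope classical_set_scope.
Local Open Scope ring_scope.

(** * Pointwise continuity *)

(** The exponent is even because [(1 + w)^2 / 4w] and its complement to 1 are squares up to the
    factor 4w. With D = d^m, the point over w = D has x^m : y^m : z^m = (1+D)^2 : -(1-D)^2 : -4D,
    and an m-th root of a square is an N-th root of 1+D or 1-D. For |D| <= 1 these two numbers lie
    in the open right half-plane or vanish, and there the principal N-th root is continuous. Hence
    each face has a single explicit formula valid on the whole closed disc, and the m faces differ
    only by the m-th root of -1 placed in front of y. The definition of [bounded_by] cuts the circle
    into equal arcs that must follow the parameter of the edges; this dictates the parametrisation
    of the edges by powers of sines. If vertices and faces are indexed modulo m suitably, the edge
    from index i to index j borders the faces j-i and j-i+1. These have opposite parity, and parity
    survives reduction modulo m because m is even; so the color of a face is the parity of its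
    index. Finitely many closed faces cover the surface and share a vertex, which yields compactness
    and connectedness. *)

Section Continuity.

Lemma cts_comp (T U V : topologicalType) (f : U -> V) (g : T -> U) x :
  continuous_at x g -> continuous_at (g x) f ->
  continuous_at x (fun y => f (g y)).
Proof. exact: continuous_comp. Qed.

Lemma cts_cst (T U : topologicalType) (a : U) (x : T) :
  continuous_at x (fun=> a).
Proof. exact: cvg_cst. Qed.

Lemma cts_id (T : topologicalType) (x : T) : continuous_at x (fun y => y).
Proof. exact: cvg_id. Qed.

Lemma cts_pair (T U V : topologicalType) (f : T -> U) (g : T -> V) x :
  continuous_at x f -> continuous_at x g ->
  continuous_at x (fun y => (f y, g y)).
Proof. by move=> hf hg; exact: (cvg_pair hf hg). Qed.

Variables (K : numFieldType) (T : topologicalType).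
Implicit Types (f g : T -> K) (x : T).

Lemma ctsD f g x : continuous_at x f -> continuous_at x g ->
  continuous_at x (fun y => f y + g y).
Proof. by move=> hf hg; exact: (cvgD hf hg). Qed.

Lemma ctsM f g x : continuous_at x f -> continuous_at x g ->
  continuous_at x (fun y => f y * g y).
Proof. by move=> hf hg; exact: (cvgM hf hg). Qed.

Lemma ctsN f x : continuous_at x f -> continuous_at x (fun y => - f y).
Proof. by move=> hf; exact: (cvgN hf). Qed.

Lemma ctsV f x : f x != 0 -> continuous_at x f ->
  continuous_at x (fun y => (f y)^-1).
Proof. by move=> h hf; exact: (cvgV h hf). Qed.

Lemma ctsX f x n : continuous_at x f ->
  continuous_at x (fun y => f y ^+ n).
Proof.
move=> hf; elim: n => [|n IH]; first exact: cts_cst.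
by under eq_fun do rewrite exprS; exact: ctsM.
Qed.

Lemma cts_sum (I : Type) (r : seq I) (F : I -> T -> K) x :
  (forall i, continuous_at x (F i)) ->
  continuous_at x (fun y => \sum_(i <- r) F i y).
Proof.
move=> h; elim: r => [|i r IH].
  by under eq_fun do rewrite big_nil; exact: cts_cst.
by under eq_fun do rewrite big_cons; exact: ctsD.
Qed.

Lemma near_neq0 f x : continuous_at x f -> f x != 0 ->
  \forall y \near x, f y != 0.
Proof. by move=> h fx; exact: (cvgr_neq0 _ h). Qed.

End Continuity.

Lemma near_gt0 (R : realType) (T : topologicalType) (f : T -> R) x :
  continuous_at x f -> 0 < f x -> \forall y \near x, 0 < f y.
Proof. by move=> h fx; exact: (cvgr_gt _ h). Qed.

Lemma cts_near (T U : topologicalType) (f : T -> U) x (P : U -> Prop) :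
  continuous_at x f -> (\forall y \near f x, P y) -> \forall y \near x, P (f y).
Proof. by move=> h hP; exact: (h P hP). Qed.

(** * Complex numbers *)

(* An alias of [R[i]] for which the topology of numerical fields is inferred. *)
Definition Cx (R : realType) : numClosedFieldType := R[i].
Arguments Cx : simpl never.

Section Complex.
Variable R : realType.
Local Notation C := (Cx R).
Implicit Types (z w : C) (x y t : R).

Definition mkC x y : C := (x +i* y)%C.
Definition re z : R := complex.Re z.
Definition im z : R := complex.Im z.
Definition rc x : C := mkC x 0.
Definition cj z : C := mkC (re z) (- im z).
Definition nm z : R := Num.sqrt (re z ^+ 2 + im z ^+ 2).

Lemma mkCE z : z = mkC (re z) (im z). Proof. by case: z. Qed.
Lemma reE x y : re (mkC x y) = x. Proof. by []. Qed.
Lemma imE x y : im (mkC x y) = y. Proof. by []. Qed.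
Lemma eqC z w : re z = re w -> im z = im w -> z = w.
Proof. by move=> h1 h2; rewrite (mkCE z) (mkCE w) h1 h2. Qed.
Lemma reD z w : re (z + w) = re z + re w. Proof. by case: z; case: w. Qed.
Lemma imD z w : im (z + w) = im z + im w. Proof. by case: z; case: w. Qed.
Lemma reN z : re (- z) = - re z. Proof. by case: z. Qed.
Lemma imN z : im (- z) = - im z. Proof. by case: z. Qed.
Lemma reM z w : re (z * w) = re z * re w - im z * im w.
Proof. by case: z; case: w. Qed.
Lemma imM z w : im (z * w) = re z * im w + im z * re w.
Proof. by case: z; case: w. Qed.
Lemma re0 : re 0 = 0. Proof. by []. Qed.
Lemma im0 : im 0 = 0. Proof. by []. Qed.
Lemma re1 : re 1 = 1. Proof. by []. Qed.
Lemma im1 : im 1 = 0. Proof. by []. Qed.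
Lemma rerc x : re (rc x) = x. Proof. by []. Qed.
Lemma imrc x : im (rc x) = 0. Proof. by []. Qed.
Lemma recj z : re (cj z) = re z. Proof. by []. Qed.
Lemma imcj z : im (cj z) = - im z. Proof. by []. Qed.
Definition cE := (reD, imD, reN, imN, reM, imM, re0, im0, re1, im1, rerc, imrc,
  reE, imE, recj, imcj).

Lemma rc_additive : {morph rc : x y / x - y}.
Proof. by move=> x y; apply: eqC; rewrite !cE //= subr0. Qed.
Lemma rc_multiplicative : monoid_morphism rc.
Proof. by split=> // x y; apply: eqC; rewrite !cE; ring. Qed.
HB.instance Definition _ := GRing.isZmodMorphism.Build R C rc rc_additive.
HB.instance Definition _ := GRing.isMonoidMorphism.Build R C rc rc_multiplicative.

Lemma rcM x y : rc (x * y) = rc x * rc y. Proof. exact: rmorphM. Qed.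
Lemma rcN x : rc (- x) = - rc x. Proof. exact: rmorphN. Qed.
Lemma rcX x k : rc (x ^+ k) = rc x ^+ k. Proof. exact: rmorphXn. Qed.
Lemma rcV x : rc x^-1 = (rc x)^-1. Proof. exact: fmorphV. Qed.
Lemma rc_inj : injective rc. Proof. by move=> x y []. Qed.
Lemma rc_eq0 x : (rc x == 0) = (x == 0). Proof. exact: fmorph_eq0. Qed.

Lemma cj_additive : {morph cj : x y / x - y}.
Proof. by move=> z w; apply: eqC; rewrite !cE //; ring. Qed.
Lemma cj_multiplicative : monoid_morphism cj.
Proof. by split=> [|z w]; apply: eqC; rewrite !cE; ring. Qed.
HB.instance Definition _ := GRing.isZmodMorphism.Build C C cj cj_additive.
HB.instance Definition _ := GRing.isMonoidMorphism.Build C C cj cj_multiplicative.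

Lemma nm_ge0 z : 0 <= nm z. Proof. exact: sqrtr_ge0. Qed.
Lemma nm2 z : nm z ^+ 2 = re z ^+ 2 + im z ^+ 2.
Proof. by rewrite sqr_sqrtr // addr_ge0 // sqr_ge0. Qed.
Lemma mulcj z : z * cj z = rc (nm z ^+ 2).
Proof. by rewrite nm2; apply: eqC; rewrite !cE; ring. Qed.
Lemma nmM z w : nm (z * w) = nm z * nm w.
Proof.
rewrite -sqrtrM; last by rewrite addr_ge0 // sqr_ge0.
by congr Num.sqrt; rewrite !cE; ring.
Qed.
Lemma nm_rc x : nm (rc x) = `|x|.
Proof. by rewrite /nm !cE expr0n addr0 sqrtr_sqr. Qed.
Lemma nm0 : nm 0 = 0. Proof. by rewrite -[0]/(rc 0) nm_rc normr0. Qed.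
Lemma nm1 : nm 1 = 1. Proof. by rewrite -[1]/(rc 1) nm_rc normr1. Qed.
Lemma normrE z : `|z| = rc (nm z). Proof. exact: normc_def. Qed.
Lemma nm_eq0 z : (nm z == 0) = (z == 0).
Proof. by rewrite -rc_eq0 -normrE normr_eq0. Qed.
Lemma nm_gt0 z : (0 < nm z) = (z != 0).
Proof. by rewrite lt_def nm_ge0 andbT nm_eq0. Qed.
Lemma nmX z k : nm (z ^+ k) = nm z ^+ k.
Proof. by elim: k => [|k IH]; rewrite ?nm1 // !exprS nmM IH. Qed.
Lemma nmV z : nm z^-1 = (nm z)^-1.
Proof. by apply: rc_inj; rewrite -normrE normfV normrE fmorphV. Qed.
Lemma nm_cj z : nm (cj z) = nm z.
Proof. by rewrite /nm recj imcj sqrrN. Qed.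
Lemma nmN z : nm (- z) = nm z.
Proof. by rewrite /nm !cE !sqrrN. Qed.
Lemma re_le_nm z : `|re z| <= nm z.
Proof. by rewrite -sqrtr_sqr ler_wsqrtr // lerDl sqr_ge0. Qed.
Lemma im_le_nm z : `|im z| <= nm z.
Proof. by rewrite -sqrtr_sqr ler_wsqrtr // lerDr sqr_ge0. Qed.
Lemma nm_le z : nm z <= `|re z| + `|im z|.
Proof.
rewrite -(ler_pXn2r (ltn0Sn 1)) ?nnegrE ?nm_ge0 ?addr_ge0 //.
rewrite nm2 sqrrD !real_normK ?num_real // lerD2r lerDl.
by rewrite mulrn_wge0 // mulr_ge0.
Qed.
Lemma rc_gt0 (e : C) : 0 < e -> e = rc (re e) /\ 0 < re e.
Proof.
case: e => a b; rewrite ltcE /= => /andP[/eqP b0 a0]; split => //.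
by rewrite /rc /re /= b0.
Qed.
Lemma ltrc x y : (rc x < rc y) = (x < y).
Proof. by rewrite ltcE /= eqxx. Qed.

(** A ball of the numerical field [C] has a complex radius; being positive in the partial order,
    this radius is real. Neighborhoods can therefore be tested with real radii and [nm]. *)
Lemma nbhsC_P z (A : set C) :
  nbhs z A <-> exists2 e : R, 0 < e & forall w, nm (z - w) < e -> A w.
Proof.
split.
  move/nbhs_ballP => [e /= /rc_gt0[-> e0] h]; exists (re e) => // w hw.
  by apply: h; rewrite /ball /= normrE ltrc.
move=> [e e0 h]; apply/nbhs_ballP; exists (rc e) => /=.
  by rewrite -[0]/(rc 0) ltrc.
by move=> w; rewrite /ball /= normrE ltrc => /h.
Qed.

Lemma rc_continuous : continuous rc.
Proof.
move=> x A /nbhsC_P[e e0 h]; apply/nbhs_ballP; exists e => // y hy.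
by apply: h; rewrite -rmorphB nm_rc.
Qed.
Lemma re_continuous : continuous re.
Proof.
move=> z A /nbhs_ballP[e e0 h]; apply/nbhsC_P; exists e => // w hw.
by apply: h; rewrite /ball /= -reN -reD (le_lt_trans (re_le_nm _)).
Qed.
Lemma im_continuous : continuous im.
Proof.
move=> z A /nbhs_ballP[e e0 h]; apply/nbhsC_P; exists e => // w hw.
by apply: h; rewrite /ball /= -imN -imD (le_lt_trans (im_le_nm _)).
Qed.
Lemma nm_continuous : continuous nm.
Proof.
move=> z; apply: (@continuous_comp _ _ _ (fun z => re z ^+ 2 + im z ^+ 2) Num.sqrt);
  last exact: sqrt_continuous.
by apply: ctsD; apply: ctsX; [exact: re_continuous | exact: im_continuous].
Qed.

Definition toC (p : R * R) : C := mkC p.1 p.2.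
Definition ofC z : R * R := (re z, im z).
Lemma toCK : cancel toC ofC. Proof. by case. Qed.
Lemma ofCK : cancel ofC toC. Proof. by move=> z; rewrite [RHS]mkCE. Qed.
Lemma ofC_continuous : continuous ofC.
Proof.
move=> z A /nbhs_ballP[e e0 h]; apply/nbhsC_P; exists e => // w hw; apply: h.
split; rewrite /ball /=.
- by rewrite -reN -reD (le_lt_trans (re_le_nm _)).
- by rewrite -imN -imD (le_lt_trans (im_le_nm _)).
Qed.
Lemma toC_continuous : continuous toC.
Proof.
move=> p A /nbhsC_P[e e0 h]; apply/nbhs_ballP; exists (e / 2) => /=.
  by rewrite divr_gt0.
move=> q [/= h1 h2]; apply: h; apply: le_lt_trans (nm_le _) _.
by rewrite !cE (splitr e) ltrD.
Qed.
Lemma cj_continuous : continuous cj.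
Proof.
move=> z A /nbhsC_P[e e0 h]; apply/nbhsC_P; exists e => // w hw; apply: h.
by rewrite -rmorphB nm_cj.
Qed.

End Complex.

(** * Roots with positive real part *)

Section Roots.
Variable R : realType.
Local Notation C := (Cx R).
Implicit Types (z w u v : C) (x y t r : R) (k : nat).

Definition expi t : C := mkC (cos t) (sin t).

Lemma expiD x y : expi (x + y) = expi x * expi y.
Proof. by apply: eqC; rewrite !cE ?cosD ?sinD; ring. Qed.
Lemma expi0 : expi 0 = 1. Proof. by rewrite /expi cos0 sin0. Qed.
Lemma expi_pi : expi pi = -1.
Proof. by rewrite /expi cospi sinpi; apply: eqC; rewrite !cE ?oppr0. Qed.
Lemma nm_expi t : nm (expi t) = 1.
Proof. by rewrite /nm !cE cos2Dsin2 sqrtr1. Qed.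
Lemma expi_neq0 t : expi t != 0.
Proof. by rewrite -nm_eq0 nm_expi oner_eq0. Qed.
Lemma expiN t : expi (- t) = (expi t)^-1.
Proof.
apply: (mulfI (expi_neq0 t)).
by rewrite -expiD subrr expi0 divff // expi_neq0.
Qed.
Lemma expiX t k : expi t ^+ k = expi (k%:R * t).
Proof.
elim: k => [|k IH]; first by rewrite mul0r expi0.
by rewrite exprS IH -expiD; congr expi; rewrite -(natr1 k); ring.
Qed.
Lemma expi_continuous : continuous expi.
Proof.
move=> t; apply: (@continuous_comp _ _ _ (fun t => (cos t, sin t)) (@toC R)).
  by apply: cts_pair; [exact: continuous_cos | exact: continuous_sin].
exact: toC_continuous.
Qed.

Lemma expi_eq1 t : `|t| < 2 * pi -> expi t = 1 -> t = 0.
Proof.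
move=> ht [ct _]; apply/eqP; rewrite -normr_eq0; apply: contraT => t0.
have t1 : 0 < `|t| by rewrite lt_def t0 /=.
have : 0 < sin (`|t| / 2) by apply: sin_gt0_pi; lra.
move: ct; rewrite -cos_norm {1}(_ : `|t| = (`|t| / 2) *+ 2); last first.
  by rewrite mulr2n; field.
rewrite cos_mulr2n cos2sin2 => h s0.
have : 0 < sin (`|t| / 2) ^+ 2 by rewrite exprn_gt0.
lra.
Qed.

(* An argument of [z] only when [0 < re z]; [arg 0] is [0]. *)
Definition arg z : R := atan (im z / re z).

Lemma arg_bound z : - (pi / 2) < arg z < pi / 2.
Proof. by rewrite atan_gtNpi2 atan_ltpi2. Qed.

Lemma polar_arg z : 0 < re z -> z = rc (nm z) * expi (arg z).
Proof.
move=> z0; have c0 : 0 < cos (arg z) by apply: cos_gt0_pihalf; exact: arg_bound.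
have ht : tan (arg z) = im z / re z by exact: atanK.
have hi : im z * cos (arg z) = re z * sin (arg z).
  have -> : sin (arg z) = tan (arg z) * cos (arg z).
    by rewrite /tan mulfVK // gt_eqF.
  by rewrite ht; field; rewrite gt_eqF.
have hn : nm z * cos (arg z) = re z.
  apply/eqP; rewrite -(eqrXn2 (ltn0Sn 1)) ?mulr_ge0 ?nm_ge0 // ?ltW //.
  rewrite exprMn nm2 mulrDl -[im z ^+ 2 * _]exprMn hi exprMn -mulrDr cos2Dsin2 mulr1.
  by [].
apply: eqC; rewrite !cE mul0r ?subr0 ?addr0 ?hn //.
by apply: (mulIf (lt0r_neq0 c0)); rewrite hi -hn; ring.
Qed.

Lemma arg_polar r t : 0 < r -> - (pi / 2) < t < pi / 2 ->
  arg (rc r * expi t) = t.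
Proof.
move=> r0 ht; rewrite /arg !cE !mul0r subr0 addr0.
rewrite -[RHS](tanK (x := t)) ?in_itv //=; congr atan; rewrite /tan.
have c0 : 0 < cos t by exact: cos_gt0_pihalf.
by field; rewrite !gt_eqF.
Qed.

Lemma re_polar r t : re (rc r * expi t) = r * cos t.
Proof. by rewrite !cE mul0r subr0. Qed.
Lemma nm_polar r t : 0 <= r -> nm (rc r * expi t) = r.
Proof. by move=> r0; rewrite nmM nm_rc nm_expi mulr1 ger0_norm. Qed.

Lemma arg_continuous z : 0 < re z -> continuous_at z arg.
Proof.
move=> z0; apply: (@continuous_comp _ _ _ (fun z => im z / re z) (@atan R));
  last exact: continuous_atan.
apply: ctsM; first exact: im_continuous.
by apply: ctsV; [rewrite gt_eqF | exact: re_continuous].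
Qed.

(** The principal k-th root, used only on the open right half-plane and at 0. The sector of
    half-angle pi/2k defined next is its image of the right half-plane. *)
Definition rho k z : C := rc (nm z `^ k%:R^-1) * expi (arg z / k%:R).
Definition sector k : set C := [set z | 0 < re z /\ `|arg z| < pi / 2 / k%:R].

Lemma rootXK k x : (0 < k)%N -> 0 <= x -> (x `^ k%:R^-1) ^+ k = x.
Proof.
move=> k0 x0; rewrite -powR_mulrn ?powR_ge0 // -powRrM mulVf ?powRr1 //.
by rewrite pnatr_eq0 -lt0n.
Qed.

Lemma XrootK k x : (0 < k)%N -> 0 <= x -> (x ^+ k) `^ k%:R^-1 = x.
Proof.
move=> k0 x0; rewrite -powR_mulrn // -powRrM mulfV ?powRr1 //.
by rewrite pnatr_eq0 -lt0n.
Qed.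

Lemma rhoK k z : (0 < k)%N -> 0 < re z -> rho k z ^+ k = z.
Proof.
move=> k0 z0; rewrite exprMn -rmorphXn rootXK ?nm_ge0 // expiX [RHS]polar_arg //.
by congr (_ * expi _); field; rewrite pnatr_eq0 -lt0n.
Qed.

Lemma rho_polar k r t : (0 < k)%N -> 0 <= r ->
  (0 < r -> - (pi / 2) < t < pi / 2) ->
  rho k (rc r * expi t) = rc (r `^ k%:R^-1) * expi (t / k%:R).
Proof.
move=> k0; rewrite le_eqVlt => /predU1P[<- _|r0 /(_ r0) ht].
  rewrite /rho rmorph0 mul0r nm0 powR0 ?rmorph0 ?mul0r //.
  by rewrite invr_eq0 pnatr_eq0 -lt0n.
by rewrite /rho arg_polar // nm_polar // ltW.
Qed.

Lemma rho0 k : (0 < k)%N -> rho k 0 = 0.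
Proof.
move=> k0; rewrite /rho nm0 powR0 ?rmorph0 ?mul0r //.
by rewrite invr_eq0 pnatr_eq0 -lt0n.
Qed.

Lemma div_pihalf k t : (0 < k)%N -> - (pi / 2) < t < pi / 2 ->
  `|t / k%:R| < pi / 2 / k%:R.
Proof.
move=> k0 ht; rewrite normrM normfV (ger0_norm (ler0n _ _)).
by rewrite ltr_pM2r ?invr_gt0 ?ltr0n // ltr_norml.
Qed.

Lemma lt_pihalf k t : (0 < k)%N -> `|t| < pi / 2 / k%:R -> - (pi / 2) < t < pi / 2.
Proof.
move=> k0 ht; rewrite -ltr_norml; apply: lt_le_trans ht _.
by rewrite ler_pdivrMr ?ltr0n // ler_peMr ?ler1n // divr_ge0 ?pi_ge0.
Qed.

Lemma rho_sector k z : (0 < k)%N -> 0 < re z -> sector k (rho k z).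
Proof.
move=> k0 z0; have h := div_pihalf k0 (arg_bound z); have h' := lt_pihalf k0 h.
have r0 : 0 < nm z `^ k%:R^-1.
  by rewrite powR_gt0 // nm_gt0; apply: contraTneq z0 => ->; rewrite ltxx.
by split; rewrite /rho ?arg_polar // re_polar mulr_gt0 // cos_gt0_pihalf.
Qed.

Lemma sector_neq0 k z : sector k z -> z != 0.
Proof. by case=> h _; apply: contraTneq h => ->; rewrite ltxx. Qed.

Lemma sectorX k z : (0 < k)%N -> sector k z ->
  z ^+ k = rc (nm z ^+ k) * expi (arg z * k%:R) /\ `|arg z * k%:R| < pi / 2.
Proof.
move=> k0 [z0 hz]; split.
  by rewrite {1}(polar_arg z0) exprMn expiX rmorphXn (mulrC k%:R).
by rewrite normrM (ger0_norm (ler0n _ k)) -ltr_pdivlMr ?ltr0n.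
Qed.

Lemma sector_re k z : (0 < k)%N -> sector k z -> 0 < re (z ^+ k).
Proof.
move=> k0 hz; have [-> h] := sectorX k0 hz.
rewrite re_polar mulr_gt0 ?exprn_gt0 ?nm_gt0 ?(sector_neq0 hz) //.
by apply: cos_gt0_pihalf; rewrite -ltr_norml.
Qed.

Lemma sectorK k z : (0 < k)%N -> sector k z -> rho k (z ^+ k) = z.
Proof.
move=> k0 hz; have [-> h] := sectorX k0 hz.
rewrite rho_polar ?exprn_ge0 ?nm_ge0 //; last by rewrite -ltr_norml.
rewrite XrootK ?nm_ge0 // [RHS]polar_arg; last by case: hz.
by congr (_ * expi _); field; rewrite pnatr_eq0 -lt0n.
Qed.

(* The arguments of [u] and [v] differ by less than [pi], hence by less than
   [pi / 2] when the quotient has positive real part. *)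
Lemma rho_div k u v : (0 < k)%N -> 0 < re u -> 0 < re v -> 0 < re (u / v) ->
  rho k (u / v) = rho k u / rho k v.
Proof.
move=> k0 u0 v0; have := arg_bound u; have := arg_bound v => bv bu.
have nu : 0 < nm u by rewrite nm_gt0; apply: contraTneq u0 => ->; rewrite ltxx.
have nv : 0 < nm v by rewrite nm_gt0; apply: contraTneq v0 => ->; rewrite ltxx.
have E : u / v = rc (nm u / nm v) * expi (arg u - arg v).
  rewrite {1}(polar_arg u0) {1}(polar_arg v0) invfM -expiN mulrACA -expiD.
  by rewrite -fmorphV -rmorphM.
rewrite E re_polar pmulr_rgt0 ?divr_gt0 // => c0.
rewrite rho_polar ?divr_ge0 ?nm_ge0 // => [|_].
  rewrite /rho invfM -expiN mulrACA -expiD -fmorphV -rmorphM; congr (rc _ * expi _).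
    by rewrite powRM ?invr_ge0 ?nm_ge0 // -[(nm v)^-1]powR_inv1 ?nm_ge0 // -powRrM mulN1r powRN.
  by field; rewrite pnatr_eq0 -lt0n.
rewrite -ltr_norml ltNge; apply/negP => h.
have : 0 <= sin (`|arg u - arg v| - pi / 2).
  by apply: sin_ge0_pi; rewrite subr_ge0 h /= lerBlDl ler_norml; lra.
by rewrite sinBpihalf cos_norm; lra.
Qed.

Lemma rho_continuous k z : (0 < k)%N -> 0 < re z \/ z = 0 ->
  continuous_at z (rho k).
Proof.
move=> k0 [z0|->].
  apply: ctsM.
    apply: (@continuous_comp _ _ _ (fun z => nm z `^ k%:R^-1) (@rc R));
      last exact: rc_continuous.
    apply: (@continuous_comp _ _ _ (@nm R) (fun x => x `^ k%:R^-1)).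
      exact: nm_continuous.
    apply: differentiable_continuous; apply/derivable1_diffP.
    apply: derivable_powR; rewrite in_itv /= andbT nm_gt0.
    by apply: contraTneq z0 => ->; rewrite ltxx.
  apply: (@continuous_comp _ _ _ (fun z => arg z / k%:R) expi);
    last exact: expi_continuous.
  by apply: ctsM; [exact: arg_continuous | exact: cts_cst].
(* Near 0 the argument is irrelevant: the modulus of [rho k w] is the k-th root of that of [w] for
   every [w], so radius e^k serves for e. *)
move=> A; rewrite rho0 // => /nbhsC_P[e e0 h]; apply/nbhsC_P.
exists (e ^+ k); rewrite ?exprn_gt0 // => w; rewrite sub0r nmN => hw; apply: h.
rewrite sub0r nmN /rho nm_polar ?powR_ge0 //.
by rewrite -(ltr_pXn2r k0) ?nnegrE ?powR_ge0 ?ltW // rootXK ?nm_ge0.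
Qed.

Lemma sector_open k : open (sector k).
Proof.
rewrite openE => z [/= z0 hz].
have h1 := near_gt0 (@re_continuous R z) z0.
have h2 : \forall w \near z, 0 < pi / 2 / k%:R - `|arg w|.
  apply: near_gt0; last by rewrite subr_gt0.
  apply: ctsD; first exact: cts_cst.
  apply: ctsN; apply: (cts_comp (f := fun x : R => `|x|)).
    exact: arg_continuous.
  exact: norm_continuous.
near=> w; split; first by near: w.
by rewrite -subr_gt0; near: w.
Unshelve. all: by end_near.
Qed.

End Roots.

(** * Complex differentiability and winding numbers *)

Section Orientation.
Variable R : realType.
Local Notation C := (Cx R).
Implicit Types (f g u x : C -> C) (p z w : C).

(* Complex differentiability at [p] with nonzero derivative, in Caratheodory's
   form: the difference quotient [k] is continuous at [p]. *)
Definition cdiff f p := exists k : C -> C,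
  [/\ \forall z \near p, f z - f p = (z - p) * k z, continuous_at p k & k p != 0].

Lemma cdiff_id p : cdiff (fun z => z) p.
Proof.
exists (fun=> 1); split; [|exact: cts_cst|exact: oner_neq0].
by near=> z; rewrite mulr1.
Unshelve. all: by end_near.
Qed.

Lemma cdiff_near f g p : (\forall z \near p, f z = g z) -> cdiff f p -> cdiff g p.
Proof.
move=> fg [k [h kc k0]]; exists k; split => //.
by have <- := nbhs_singleton fg; near=> z; rewrite -(near fg z) //; near: z.
Unshelve. all: by end_near.
Qed.

Lemma cdiff_inv f p : continuous_at p f -> f p != 0 -> cdiff f p ->
  cdiff (fun z => (f z)^-1) p.
Proof.
move=> fc f0 [k [h kc k0]]; exists (fun z => - k z / (f z * f p)); split.
- have nf := near_neq0 fc f0.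
  near=> z; have nz : f z != 0 by near: z.
  have hz : f z - f p = (z - p) * k z by near: z.
  have -> : (z - p) * (- k z / (f z * f p)) = - (f z - f p) / (f z * f p).
    by rewrite hz mulrA mulrN.
  by move: (f z) (f p) nz f0 => a b a0 b0; field; rewrite a0 b0.
- apply: ctsM; first exact: ctsN.
  by apply: ctsV; [exact: mulf_neq0 | apply: ctsM; [exact: fc | exact: cts_cst]].
- by apply: mulf_neq0; [rewrite oppr_eq0 | rewrite invr_eq0; exact: mulf_neq0].
Unshelve. all: by end_near.
Qed.

(** Implicit differentiation of u^m + x^m = -1 in algebraic form. Factor a^m - b^m as (a - b) P(a,
    b); then P(a, a) = m a^(m-1) is nonzero for a nonzero, and the difference quotient of [u] is
    that of [x] times a quotient of two values of P. *)
Lemma cdiff_fermat m u x p : (0 < m)%N ->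
  (\forall z \near p, u z ^+ m = - 1 - x z ^+ m) ->
  continuous_at p u -> continuous_at p x -> u p != 0 -> x p != 0 ->
  cdiff x p -> cdiff u p.
Proof.
move=> m0 h uc xc u0 x0 [k [hx kc k0]].
pose P (a b : C) := \sum_(i < m) a ^+ (m.-1 - i) * b ^+ i.
have Pn a : a != 0 -> P a a != 0.
  move=> a0; rewrite /P (eq_bigr (fun=> a ^+ m.-1)).
    rewrite sumr_const card_ord -mulr_natl mulf_neq0 ?expf_neq0 //.
    by rewrite pnatr_eq0 -lt0n.
  by move=> i _; rewrite -exprD subnK // -ltnS prednK.
have Pc (v : C -> C) b : continuous_at p v -> continuous_at p (fun z => P (v z) b).
  move=> vc; apply: cts_sum => i; apply: ctsM; first by apply: ctsX; exact: vc.
  exact: cts_cst.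
exists (fun z => - (k z * P (x z) (x p)) / P (u z) (u p)); split.
- have nP := near_neq0 (Pc _ (u p) uc) (Pn _ u0).
  have hp := nbhs_singleton h.
  near=> z; have nz : P (u z) (u p) != 0 by near: z.
  have hz : u z ^+ m = - 1 - x z ^+ m by near: z.
  have hxz : x z - x p = (z - p) * k z by near: z.
  apply: (mulIf nz); rewrite -mulrA mulfVK // -subrXX hz hp mulrN mulrA -hxz -subrXX.
  by move: (x z ^+ m) (x p ^+ m) => a b; ring.
- apply: ctsM.
    by apply: ctsN; apply: ctsM; [exact: kc | apply: Pc; exact: xc].
  by apply: ctsV; [exact: Pn | apply: Pc; exact: uc].
- apply: mulf_neq0; last by rewrite invr_eq0 Pn.
  by rewrite oppr_eq0; apply: mulf_neq0 => //; exact: Pn.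
Unshelve. all: by end_near.
Qed.

Lemma exists_arg z : exists t, z = rc (nm z) * expi t.
Proof.
have [z0|z0|z0] := ltgtP (re z) 0.
- exists (arg (- z) + pi).
  have h : 0 < re (- z) by rewrite reN oppr_gt0.
  rewrite expiD expi_pi mulrN1 mulrN -nmN -polar_arg // opprK //.
- by exists (arg z); exact: polar_arg.
- exists (if 0 <= im z then pi / 2 else - (pi / 2)).
  have -> : nm z = `|im z| by rewrite /nm z0 expr0n add0r sqrtr_sqr.
  case: ifPn => h; apply: eqC; rewrite ?z0 !cE ?cosN ?sinN cos_pihalf ?sin_pihalf.
  + by ring.
  + by rewrite ger0_norm //; ring.
  + by ring.
  + by rewrite ltr0_norm ?ltNge //; ring.
Qed.

Lemma toC_polar (p : R * R) r t : toC (polar p r t) = toC p + rc r * expi t.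
Proof. by apply: eqC; rewrite !cE /=; ring. Qed.

(** On a small circle, f(P + r e^(it)) - f(P) is r e^(it) times k(P) times a factor [ka t] in the
    right half-plane. That factor has a continuous argument returning to its initial value, so only
    e^(it) contributes to the winding. *)
Lemma winds_cdiff f (p : R * R) (A : set (R * R)) : nbhs p A ->
  (forall q, A q -> continuous_at (toC q) f) -> cdiff f (toC p) ->
  exists r : R, [/\ 0 < r, (forall s t, 0 <= s <= r -> A (polar p s t)) &
    winds_once (fun t => ofC (f (toC (polar p r t)))) (ofC (f (toC p)))].
Proof.
set P := toC p => nA fc [k [hk kc k0]].
have nA' : nbhs P [set z | A (ofC z)].
  by apply: (@ofC_continuous R P A); rewrite /P toCK.
have h1 : \forall z \near P, 0 < re (k z / k P).
  apply: near_gt0; last by rewrite divff // re1.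
  apply: (cts_comp (f := @re R)); last exact: re_continuous.
  by apply: ctsM; [exact: kc | exact: cts_cst].
have /nbhsC_P[e e0 he] : \forall z \near P,
    [/\ A (ofC z), 0 < re (k z / k P) & f z - f P = (z - P) * k z].
  by near=> z; split; near: z.
have hr s t : 0 <= s <= e / 2 -> nm (P - (P + rc s * expi t)) < e.
  move=> /andP[s0 s1]; rewrite opprD addNKr nmN nm_polar //; lra.
have r0 : 0 < e / 2 by rewrite divr_gt0.
exists (e / 2); split=> [//|s t hs|].
  by have [+ _ _] := he _ (hr s t hs); rewrite -toC_polar toCK.
set r := e / 2 in r0 hr *.
pose ga t := P + rc r * expi t.
pose ka t := (f (ga t) - f P) / (rc r * expi t) / k P.
have rn t : rc r * expi t != 0 by rewrite mulf_neq0 ?expi_neq0 // rc_eq0 gt_eqF.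
have hga t : [/\ A (ofC (ga t)), 0 < re (ka t) & f (ga t) - f P = rc r * expi t * k P * ka t].
  have /he[a b c] : nm (P - ga t) < e by apply: hr; rewrite lexx ltW.
  have hg : ga t - P = rc r * expi t by rewrite /ga addrAC subrr add0r.
  have E : ka t = k (ga t) / k P.
    by rewrite /ka c hg (mulrC (rc r * _) (k _)) mulfK.
  by split; rewrite ?E // c hg -[RHS]mulrA (mulrC (k P)) divfK.
have gac : continuous ga.
  move=> t; apply: ctsD; first exact: cts_cst.
  by apply: ctsM; [exact: cts_cst | exact: expi_continuous].
have kac : continuous ka.
  move=> t; apply: ctsM; last exact: cts_cst.
  apply: ctsM.
    apply: ctsD; last by apply: ctsN; exact: cts_cst.
    apply: (cts_comp (f := f)); first exact: gac.
    by have [+ _ _] := hga t; move=> /fc; rewrite ofCK.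
  apply: ctsV; first exact: rn.
  apply: ctsM; [exact: cts_cst | exact: expi_continuous].
have [c hc] := exists_arg (k P).
exists (fun t => t + c + arg (ka t)), (fun t => r * nm (k P) * nm (ka t)); split.
- apply: continuous_subspaceT => t; apply: ctsD.
    by apply: ctsD; [exact: cts_id | exact: cts_cst].
  apply: (cts_comp (f := @arg R)); first exact: kac.
  by apply: arg_continuous; have [] := hga t.
- move=> t _; have [_ h _] := hga t.
  rewrite !mulr_gt0 // nm_gt0 //.
  by apply: contraTneq h => ->; rewrite ltxx.
- move=> t _; have [_ h1' h2] := hga t.
  rewrite -[RHS]toCK; congr ofC; rewrite !toC_polar ofCK -/P -/(ga t).
  apply/eqP; rewrite addrC -subr_eq; apply/eqP; rewrite h2.
  rewrite {1}hc {1}(polar_arg h1') !expiD (rcM (r * _)) (rcM r).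
  move: (expi _) (expi _) (expi _) (rc r) (rc _) (rc _) => *; ring.
- rewrite /ka /ga mulrC (_ : pi * 2 = pi *+ 2) ?mulr_natr //.
  have -> : expi (pi *+ 2) = expi (0 : R).
    by rewrite /expi cos2pi sin2pi cos0 sin0.
  ring.
Unshelve. all: by end_near.
Qed.

End Orientation.

(** * The Fermat curve *)

Section FermatCurve.
Variables (R : realType) (m : nat).
Local Notation C := (Cx R).
Local Notation vec := ('I_3 -> C).
Implicit Types (v w : vec) (i j : 'I_3).

(* The point [v_0 : v_1 : v_2] of the complex projective plane is represented
   by the orthogonal projection onto the line spanned by [v]. *)
Definition projector v : 'M[C]_3 :=
  \matrix_(i, j) (v i * cj (v j) / rc (\sum_k nm (v k) ^+ 2)).

Definition on_fermat v := (exists i, v i != 0) /\ \sum_i v i ^+ m = 0.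

Definition fermat_set : set 'M[C]_3 :=
  [set M | exists2 v, on_fermat v & M = projector v].

Definition fermat : topologicalType := fermat_set.

Definition mx (p : fermat) : 'M[C]_3 := \val (p : set_type fermat_set).

Lemma mx_inj : injective mx. Proof. exact: val_inj. Qed.

Lemma sqnorm_gt0 v : (exists i, v i != 0) -> 0 < \sum_k nm (v k) ^+ 2.
Proof.
move=> [i vi]; rewrite (bigD1 i) //= ltr_wpDr //.
  by apply: sumr_ge0 => k _; exact: sqr_ge0.
by rewrite exprn_gt0 // nm_gt0.
Qed.

Lemma projector_diag v j : (exists i, v i != 0) ->
  (projector v j j != 0) = (v j != 0).
Proof.
move=> /sqnorm_gt0 h; rewrite mxE mulcj -fmorphV -rcM rc_eq0.
by rewrite mulf_eq0 invr_eq0 (gt_eqF h) orbF sqrf_eq0 nm_eq0.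
Qed.

Lemma projector_ratio v i j : (exists i, v i != 0) ->
  projector v i j / projector v j j = v i / v j.
Proof.
move=> /[dup] v0 /sqnorm_gt0 h; have [vj|vj] := eqVneq (v j) 0.
  (* Both quotients have denominator 0 and hence value 0. *)
  by rewrite !mxE vj rmorph0 !mulr0 !mul0r invr0 !mulr0.
rewrite !mxE; set s := rc _.
have s0 : s != 0 by rewrite rc_eq0 gt_eqF.
have c0 : cj (v j) != 0 by rewrite -nm_eq0 nm_cj nm_eq0.
move: (v i) (v j) (cj (v j)) s vj s0 c0 => a b c s b0 s0 c0.
by field; rewrite b0 s0 c0.
Qed.

Lemma projector_scale (c : C) v : c != 0 ->
  projector (fun i => c * v i) = projector v.
Proof.
move=> c0; apply/matrixP => i j; rewrite !mxE rmorphM /=.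
have -> : \sum_k nm (c * v k) ^+ 2 = nm c ^+ 2 * \sum_k nm (v k) ^+ 2.
  by rewrite mulr_sumr; apply: eq_bigr => k _; rewrite nmM exprMn.
have c1 : cj c != 0 by rewrite -nm_eq0 nm_cj nm_eq0.
rewrite rcM -mulcj.
have [->|s0] := eqVneq (rc (\sum_k nm (v k) ^+ 2)) 0.
  by rewrite !mulr0 invr0 !mulr0.
move: (v i) (cj (v j)) (cj c) (rc _) c1 s0 => a b d s d0 s0.
by field; rewrite c0 s0 d0.
Qed.

Hypothesis m0 : (0 < m)%N.

(** Supplies a base point, the default value of [pt]. The witness is (1 : e^(i pi/m) : 0). *)
Lemma on_fermat_exists : exists v, on_fermat v.
Proof.
exists (fun i => if i == 0 then 1 else if i == 1 then expi (pi / m%:R) else 0).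
split; first by exists 0; rewrite eqxx oner_neq0.
rewrite !big_ord_recl big_ord0 /= expr1n expiX mulrC divfK ?pnatr_eq0 -?lt0n //.
by rewrite expi_pi expr0n gtn_eqF // !addr0 subrr.
Qed.

Definition fermat_base : fermat :=
  exist _ (projector (projT1 (cid on_fermat_exists)))
    (mem_set (ex_intro2 _ _ _ (projT2 (cid on_fermat_exists)) erefl)).

(* Junk off the curve. *)
Definition pt v : fermat :=
  insubd (fermat_base : set_type fermat_set) (projector v).

Lemma mx_pt v : on_fermat v -> mx (pt v) = projector v.
Proof. by move=> h; apply: insubdK; apply: mem_set; exists v. Qed.

Lemma pt_surj (p : fermat) : exists2 v, on_fermat v & p = pt v.
Proof.
case: p => M hM; have /set_mem[v hv E] := hM; exists v => //.
by apply: mx_inj; rewrite mx_pt.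
Qed.

Definition coord i j (p : fermat) : C := mx p i j / mx p j j.
Definition nz j : set fermat := [set p | mx p j j != 0].

Lemma coord_pt i j v : on_fermat v -> coord i j (pt v) = v i / v j.
Proof. by move=> hv; rewrite /coord mx_pt // projector_ratio; case: hv. Qed.

Lemma nz_pt j v : on_fermat v -> nz j (pt v) = (v j != 0).
Proof. by move=> hv; rewrite /nz /= mx_pt // projector_diag; case: hv. Qed.

Lemma pt_scale (c : C) v : c != 0 -> pt (fun i => c * v i) = pt v.
Proof. by move=> c0; rewrite /pt projector_scale. Qed.

Lemma pt_eq v w j : v j != 0 -> w j != 0 -> (forall i, v i / v j = w i / w j) ->
  pt v = pt w.
Proof.
move=> vj wj h; rewrite -(@pt_scale (v j / w j) w) ?mulf_neq0 ?invr_eq0 //.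
congr pt; apply: funext => i.
by rewrite mulrAC -mulrA -h mulrC divfK.
Qed.

(** The normalised matrix entries are continuous in homogeneous coordinates away from the zero
    vector. The statement is for an arbitrary filter so as to give both continuity at a point and
    continuity within a set. *)
Lemma cvg_pt (T : Type) (F : set_system T) {FF : Filter F} (v : T -> vec) w :
  on_fermat w -> (\forall y \near F, on_fermat (v y)) ->
  (forall i, v y i @[y --> F] --> w i) -> pt (v y) @[y --> F] --> pt w.
Proof.
move=> hw hv vw.
have hn : (exists i, w i != 0) by case: hw.
have cw : projector (v y) @[y --> F] --> projector w.
  move=> A [P hP PA].
  have hP' ij : \forall y \near F, P ij.1 ij.2 (projector (v y) ij.1 ij.2).
    have : projector (v y) ij.1 ij.2 @[y --> F] --> projector w ij.1 ij.2.
      rewrite mxE; under eq_fun do rewrite mxE.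
      apply: cvgM.
        apply: cvgM; first exact: vw.
        by apply: continuous_cvg; [exact: cj_continuous | exact: vw].
      apply: cvgV; first by rewrite rc_eq0 gt_eqF // sqnorm_gt0.
      apply: continuous_cvg; first exact: rc_continuous.
      apply: cvg_big => [|k _]; first exact: add_continuous.
      rewrite expr2; under eq_fun do rewrite expr2.
      by apply: cvgM; apply: continuous_cvg;
        first [exact: nm_continuous | exact: vw].
    by apply; exact: hP.
  apply: (@filterS _ F _ _ _ _ (filter_forall _ hP')) => y hy.
  by apply: PA => i j; exact: (hy (i, j)).
move=> A; rewrite /nbhs /= => -[_ [[B oB <-] Bw BA]].
have hB : \forall y \near F, B (projector (v y)).
  by apply: cw; apply: open_nbhs_nbhs; split; rewrite -?(mx_pt hw).
have BA' q : B (mx q) -> A q by exact: BA.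
near=> y; apply: BA'; rewrite mx_pt; last by near: y.
by near: y.
Unshelve. all: by end_near.
Qed.

Lemma cts_pt (T : topologicalType) (v : T -> vec) x :
  (\forall y \near x, on_fermat (v y)) ->
  (forall i, continuous_at x (fun y => v y i)) ->
  continuous_at x (fun y => pt (v y)).
Proof.
by move=> h vc; apply: (@cvg_pt T (nbhs x)) => //; exact: nbhs_singleton h.
Qed.

Lemma within_pt (T : topologicalType) (A : set T) (v : T -> vec) :
  (forall y, A y -> on_fermat (v y)) ->
  (forall y, A y -> forall i, continuous_at y (fun y => v y i)) ->
  {within A, continuous (fun y => pt (v y))}.
Proof.
move=> hv vc; apply/subspace_continuousP => x Ax; apply: cvg_pt.
- exact: hv.
- by rewrite near_withinE; near=> y; exact: hv.
- by move=> i; apply: cvg_within_filter; exact: vc.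
Unshelve. all: by end_near.
Qed.

Lemma entry_continuous i j : continuous (fun p : fermat => mx p i j).
Proof.
move=> p; apply: (cts_comp (f := fun M : 'M[C]_3 => M i j)).
  exact: initial_continuous.
exact: coord_continuous.
Qed.

Lemma coord_cts i j p : nz j p -> continuous_at p (coord i j).
Proof.
move=> h; apply: ctsM; first exact: entry_continuous.
by apply: ctsV; [exact: h | exact: entry_continuous].
Qed.

Lemma near_nz j p : nz j p -> \forall q \near p, nz j q.
Proof. by move=> h; exact: (near_neq0 (@entry_continuous j j p) h). Qed.

Lemma fermat_hausdorff : hausdorff_space fermat.
Proof.
move=> p q pq; apply: mx_inj; apply/matrixP => i j.
apply: (@norm_hausdorff _ C) => A B hA hB.
have [r [rA rB]] := pq _ _ (@entry_continuous i j p _ hA) (@entry_continuous i j q _ hB).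
by exists (mx r i j).
Qed.

End FermatCurve.

(** * Charts *)

Section Charts.
Variables (R : realType) (m : nat).
Hypothesis m0 : (0 < m)%N.
Local Notation C := (Cx R).
Local Notation vec := ('I_3 -> C).
Implicit Types (v : vec) (i j : 'I_3) (w z : C).
Local Notation pt := (pt m0).

(** Coordinates are indexed cyclically, so that one family of charts, rotated by [i], treats the
    three coordinates alike. *)
Lemma ord3P i (k : 'I_3) : [\/ k = i, k = i + 1 | k = i + 2].
Proof.
have : [|| k == i, k == i + 1 | k == i + 2].
  by case: i k => -[|[|[|]]] // ? [[|[|[|]]]].
by case/or3P => /eqP; [constructor 1 | constructor 2 | constructor 3].
Qed.

Lemma ord3_neq i : [/\ (i + 1 == i) = false, (i + 2 == i) = false,
  (i + 2 == i + 1) = false, i + 1 + 1 = i + 2 & i + 1 + 2 = i].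
Proof. by case: i => -[|[|[|]]] // ?; split=> //; apply: val_inj. Qed.

Lemma ord3_add2 i : i + 2 + 1 = i /\ i + 2 + 2 = i + 1.
Proof. by case: i => -[|[|[|]]] // ?; split=> //; apply: val_inj. Qed.

Lemma sum_ord3 (V : nmodType) (F : 'I_3 -> V) i :
  \sum_k F k = F i + F (i + 1) + F (i + 2).
Proof.
have [h1 h2 h3 _ _] := ord3_neq i.
rewrite -addrA (bigD1 i) //= (bigD1 (i + 1)) ?h1 //= (big_pred1 (i + 2)) // => k.
by case: i k {h1 h2 h3} => -[|[|[|]]] // ? [[|[|[|]]]].
Qed.

(** Where the coordinate [i + 2] is 1, the equation of the curve reads v_(i+1)^m = -1 - z^m = w^m (1
    + z^m) for w^m = -1. The curve is thus locally the graph of a root over z, with [w] selecting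
    the sheet. *)
Definition chart_vec i w z : vec := fun k =>
  if k == i then z else if k == i + 1 then w * rho m (1 + z ^+ m) else 1.

Definition chart_inv i w (t : R * R) : fermat R m := pt (chart_vec i w (toC t)).
Definition chart_map i (p : fermat R m) : R * R := ofC (coord i (i + 2) p).
Definition chart_dom i w : set (fermat R m) :=
  [set p | nz (i + 2) p /\ sector m (coord (i + 1) (i + 2) p / w)].
Definition chart_cod : set (R * R) := [set t | 0 < re (1 + toC t ^+ m)].

Lemma chart_vecE i w z : [/\ chart_vec i w z i = z,
  chart_vec i w z (i + 1) = w * rho m (1 + z ^+ m) & chart_vec i w z (i + 2) = 1].
Proof.
have [h1 h2 h3 _ _] := ord3_neq i.
by rewrite /chart_vec !eqxx h1 h2 h3.
Qed.

Lemma root_neq0 w : w ^+ m = -1 -> w != 0.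
Proof.
move=> h; apply/eqP => w0; move/eqP: h.
by rewrite w0 expr0n gtn_eqF // eq_sym oppr_eq0 oner_eq0.
Qed.

Lemma rho_fermat w z : w ^+ m = -1 -> 0 < re (1 + z ^+ m) ->
  (w * rho m (1 + z ^+ m)) ^+ m = -1 - z ^+ m.
Proof. by move=> hw hz; rewrite exprMn hw rhoK // mulN1r opprD. Qed.

Lemma chart_vec_on i w z : w ^+ m = -1 -> 0 < re (1 + z ^+ m) ->
  on_fermat m (chart_vec i w z).
Proof.
move=> hw hz; have [e1 e2 e3] := chart_vecE i w z.
split; first by exists (i + 2); rewrite e3 oner_neq0.
rewrite (sum_ord3 _ i) e1 e2 e3 rho_fermat // expr1n.
by move: (z ^+ m) => a; ring.
Qed.

Lemma near_cod z : 0 < re (1 + z ^+ m) ->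
  \forall y \near z, 0 < re (1 + y ^+ m).
Proof.
move=> hz; apply: (near_gt0 (f := fun y : C => re (1 + y ^+ m))); last exact: hz.
apply: (cts_comp (f := @re R)); last exact: re_continuous.
by apply: ctsD; [exact: cts_cst | apply: ctsX; exact: cts_id].
Qed.

Lemma rho_fermat_cts w z : 0 < re (1 + z ^+ m) ->
  continuous_at z (fun y => w * rho m (1 + y ^+ m)).
Proof.
move=> hz; apply: ctsM; first exact: cts_cst.
apply: (cts_comp (f := rho m)); last by apply: rho_continuous => //; left.
by apply: ctsD; [exact: cts_cst | apply: ctsX; exact: cts_id].
Qed.

Lemma chart_inv_cts i w z : w ^+ m = -1 -> 0 < re (1 + z ^+ m) ->
  continuous_at z (fun y => pt (chart_vec i w y)).
Proof.
move=> hw hz; apply: (cts_pt (v := chart_vec i w)).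
- have := near_cod hz; apply: filterS => y; exact: chart_vec_on.
- move=> k; rewrite /chart_vec; have [_|_] := eqVneq k i; first exact: cts_id.
  by have [_|_] := eqVneq k (i + 1); [exact: rho_fermat_cts | exact: cts_cst].
Qed.

Lemma chart_inv_dom i w t : w ^+ m = -1 -> chart_cod t ->
  chart_dom i w (chart_inv i w t) /\ chart_map i (chart_inv i w t) = t.
Proof.
move=> hw ht; have [e1 e2 e3] := chart_vecE i w (toC t).
have on := chart_vec_on i hw ht.
have w0 := root_neq0 hw.
rewrite /chart_dom /chart_map /= nz_pt // !coord_pt // e1 e2 e3 !divr1.
rewrite oner_neq0 toCK mulrC mulrA mulVf // mul1r; split=> //; split=> //.
exact: rho_sector.
Qed.

Lemma chart_map_dom i w p : w ^+ m = -1 -> chart_dom i w p ->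
  chart_cod (chart_map i p) /\ chart_inv i w (chart_map i p) = p.
Proof.
move=> hw; have w0 := root_neq0 hw; have [v on ->] := pt_surj m0 p => -[].
rewrite /chart_inv /chart_cod /chart_map /= nz_pt // !coord_pt // ofCK => v2 hs.
have [e1 e2 e3] := chart_vecE i w (v i / v (i + 2)).
have E : 1 + (v i / v (i + 2)) ^+ m = (v (i + 1) / v (i + 2) / w) ^+ m.
  have [_ h] := on; move: h; rewrite (sum_ord3 _ i) => h.
  have v2m : v (i + 2) ^+ m != 0 by rewrite expf_neq0.
  rewrite 3!expr_div_n hw; apply: (mulIf v2m).
  rewrite mulrDl mul1r divfK // mulrAC divfK // invrN1 mulrN1.
  by apply/eqP; rewrite -addr_eq0 -addrA addrC h.
have hz : 0 < re (1 + (v i / v (i + 2)) ^+ m) by rewrite E; exact: sector_re.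
split=> //; apply: (@pt_eq _ _ m0 _ _ (i + 2)) => //; first by rewrite e3 oner_neq0.
move=> k; rewrite e3 divr1; case: (ord3P i k) => ->.
- by rewrite e1.
- by rewrite e2 E sectorK // mulrC divfK.
- by rewrite e3 divff.
Qed.

Lemma near_dom i w p : w ^+ m = -1 -> chart_dom i w p ->
  \forall q \near p, chart_dom i w q.
Proof.
move=> hw [h1 h2]; have w0 := root_neq0 hw.
have n1 := near_nz h1.
have n2 : \forall q \near p, sector m (coord (i + 1) (i + 2) q / w).
  have c : continuous_at p (fun q => coord (i + 1) (i + 2) q / w).
    by apply: ctsM; [exact: coord_cts | exact: cts_cst].
  by apply: c; apply: open_nbhs_nbhs; split; first exact: sector_open.
by near=> q; split; near: q.
Unshelve. all: by end_near.
Qed.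

Lemma fermat_chart i w : w ^+ m = -1 ->
  chart (chart_dom i w) chart_cod (chart_map i) (chart_inv i w).
Proof.
move=> hw; split.
- by rewrite openE => p hp; exact: near_dom.
- rewrite openE => t ht.
  apply: (@toC_continuous R t [set y | 0 < re (1 + y ^+ m)]); exact: near_cod.
- split.
  + apply/seteqP; split=> [_ [p hp <-]|t ht].
      by have [] := chart_map_dom hw hp.
    by exists (chart_inv i w t); have [] := chart_inv_dom i hw ht.
  + by move=> p hp; have [] := chart_map_dom hw hp.
  + apply: continuous_in_subspaceT => p /set_mem[hp _].
    by apply: (cts_comp (f := @ofC R)); [exact: coord_cts | exact: ofC_continuous].
  + apply: continuous_in_subspaceT => t /set_mem ht.
    apply: (cts_comp (f := fun y => pt (chart_vec i w y))).
      exact: toC_continuous.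
    exact: chart_inv_cts.
Qed.

(* Three complex numbers with sum zero cannot have pairwise nonnegative inner
   products unless they all vanish. *)
Lemma fermat_chart_cover p : exists i w, w ^+ m = -1 /\ chart_dom i w p.
Proof.
have [v on ->] := pt_surj m0 p; have [[i0 vi0] hs] := on.
suff [i v2 hi] : exists2 i, v (i + 2) != 0 & 0 < re (- (v (i + 1) / v (i + 2)) ^+ m).
  have r0 : rho m (- (v (i + 1) / v (i + 2)) ^+ m) != 0.
    exact: sector_neq0 (rho_sector m0 hi).
  have a0 : v (i + 1) / v (i + 2) != 0.
    apply: contraTneq hi => ->; rewrite expr0n gtn_eqF // oppr0 re0 ltxx //.
  (* With a the ratio of the two coordinates, w is a divided by the principal root of -a^m: then w^m
     = -1, and a / w is that root, which lies in the sector. *)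
  exists i, (v (i + 1) / v (i + 2) / rho m (- (v (i + 1) / v (i + 2)) ^+ m)); split.
    rewrite expr_div_n rhoK // invrN mulrN divff ?expf_neq0 //.
  rewrite /chart_dom /= nz_pt // coord_pt //; split=> //.
  rewrite invf_div mulrC divfK //; exact: rho_sector.
apply: contrapT => H.
have K i : 0 <= re (v (i + 1) ^+ m * cj (v (i + 2) ^+ m)).
  have [v2|v2] := eqVneq (v (i + 2)) 0.
    by rewrite v2 expr0n gtn_eqF // rmorph0 mulr0 re0.
  rewrite leNgt; apply/negP => hlt; apply: H; exists i => //.
  have v2m : v (i + 2) ^+ m != 0 by rewrite expf_neq0.
  rewrite expr_div_n reN oppr_gt0 -(pmulr_llt0 _ (x := nm (v (i + 2) ^+ m) ^+ 2)).
    move: (v (i + 1) ^+ m) (v (i + 2) ^+ m) v2m hlt => a b b0.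
    have -> : a * cj b = a / b * rc (nm b ^+ 2) by rewrite -mulcj mulrA divfK.
    by rewrite (reM (a / b)) imrc mulr0 subr0 rerc mulrC.
  by rewrite exprn_gt0 // nm_gt0.
have [h1 _ _ h11 h12] := ord3_neq i0.
have [h21 h22] := ord3_add2 i0.
have := K i0; have := K (i0 + 1); have := K (i0 + 2).
rewrite h11 h12 h21 h22.
move: hs; rewrite (sum_ord3 _ i0).
have : 0 < nm (v i0 ^+ m) ^+ 2 by rewrite exprn_gt0 // nm_gt0 expf_neq0.
rewrite nm2.
move: (v i0 ^+ m) (v (i0 + 1) ^+ m) (v (i0 + 2) ^+ m) => a b c p0 s0.
have sr : re a + re b + re c = 0 by rewrite -!reD s0.
have si : im a + im b + im c = 0 by rewrite -!imD s0.
rewrite !cE !mulrN !opprK => k1 k2 k3.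
have Ec : re c = - (re a + re b) by lra.
have Fc : im c = - (im a + im b) by lra.
rewrite Ec Fc in k1 k2 k3.
move: (re a) (re b) (im a) (im b) p0 k1 k2 k3 => x y x' y' p0 k1 k2 k3.
have : 0 <= (x + y) ^+ 2 + (x' + y') ^+ 2 by rewrite addr_ge0 // sqr_ge0.
have : 0 <= y ^+ 2 + y' ^+ 2 by rewrite addr_ge0 // sqr_ge0.
rewrite !expr2 in p0 *; nra.
Qed.

(** The chart vector has coordinates z, u(z), 1, so the new coordinate is z, u/z or 1/u. The last
    two follow from the Fermat equation, which for u/z reads (u/z)^m = -1 - (1/z)^m. Implicit
    differentiation gives a nonzero derivative only for z nonzero, and in both cases membership in
    the domain of the second chart ensures this. *)
Lemma chart_transition_cdiff i w j w' z : w ^+ m = -1 -> w' ^+ m = -1 ->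
  0 < re (1 + z ^+ m) -> chart_dom j w' (pt (chart_vec i w z)) ->
  cdiff (fun y => coord j (j + 2) (pt (chart_vec i w y))) z.
Proof.
move=> hw hw' hz.
have on := chart_vec_on i hw hz.
have [e1 e2 e3] := chart_vecE i w z.
have [h1 _ _ h11 h12] := ord3_neq i; have [h21 h22] := ord3_add2 i.
pose u y := w * rho m (1 + y ^+ m).
have nz1 : \forall y \near z, u y ^+ m = -1 - y ^+ m.
  by have := near_cod hz; apply: filterS => y hy; exact: rho_fermat.
have uc : continuous_at z u by exact: rho_fermat_cts.
have u0 : u z != 0.
  apply: mulf_neq0; first exact: root_neq0.
  exact: sector_neq0 (rho_sector m0 hz).
have near_eq (g : C -> C) :
  (forall y, g y = chart_vec i w y j / chart_vec i w y (j + 2)) ->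
  cdiff g z -> cdiff (fun y => coord j (j + 2) (pt (chart_vec i w y))) z.
  move=> hg; apply: cdiff_near; have := near_cod hz; apply: filterS => y hy.
  by rewrite (coord_pt _ _ _ (chart_vec_on i hw hy)) hg.
rewrite /chart_dom /= nz_pt // coord_pt // => -[hn hsec].
have idc : continuous_at z (fun y : C => y) by exact: cts_id.
case: (ord3P i j) => hj; subst j.
- apply: (near_eq (fun y => y)); last exact: cdiff_id.
  by move=> y; have [-> _ ->] := chart_vecE i w y; rewrite divr1.
- rewrite h12 e1 in hn.
  apply: (near_eq (fun y => u y / y)).
    by move=> y; rewrite h12; have [-> -> _] := chart_vecE i w y.
  apply: (cdiff_fermat (x := fun y => y^-1) m0).
  + have n0 : \forall y \near z, y != 0 by exact: near_neq0 idc hn.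
    near=> y; have y0 : y != 0 by near: y.
    rewrite expr_div_n (_ : u y ^+ m = -1 - y ^+ m); last by near: y.
    have ym : y ^+ m != 0 by rewrite expf_neq0.
    by rewrite exprVn; move: (y ^+ m) ym => a a0; field.
  + by apply: ctsM; [exact: uc | apply: ctsV; [exact: hn | exact: idc]].
  + by apply: ctsV; [exact: hn | exact: idc].
  + by apply: mulf_neq0; [exact: u0 | rewrite invr_eq0].
  + by rewrite invr_eq0.
  + by apply: cdiff_inv; [exact: idc | exact: hn | exact: cdiff_id].
- have z0 : z != 0.
    apply/eqP => z0; have := sector_neq0 hsec.
    by rewrite h21 e1 z0 !mul0r eqxx.
  apply: (near_eq (fun y => (u y)^-1)).
    by move=> y; rewrite h22; have [_ -> ->] := chart_vecE i w y; rewrite mul1r.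
  apply: cdiff_inv; [exact: uc | exact: u0 |].
  apply: (cdiff_fermat (x := fun y => y) m0 nz1); 
    [exact: uc | exact: idc | exact: u0 | exact: z0 | exact: cdiff_id].
Unshelve. all: by end_near.
Qed.

Lemma fermat_orientable : orientable R (fermat R m).
Proof.
exists ('I_3 * {w : C | w ^+ m = -1})%type,
  (fun k => chart_dom k.1 (sval k.2)), (fun=> chart_cod),
  (fun k => chart_map k.1), (fun k => chart_inv k.1 (sval k.2)).
split.
- by move=> [i [w hw]]; exact: fermat_chart.
- move=> p; have [i [w [hw hp]]] := fermat_chart_cover p.
  by exists (i, exist _ w hw).
move=> [i [w hw]] [j [w' hw']] /= t.
set A := _ @` _.
have AE t' : A t' -> chart_cod t' /\ chart_dom j w' (pt (chart_vec i w (toC t'))).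
  move=> [p [hp hp'] <-]; have [h1 h2] := chart_map_dom hw hp.
  by split=> //; rewrite -[pt _]/(chart_inv i w (chart_map i p)) h2.
move=> At; have [ht hj] := AE _ At.
apply: (winds_cdiff (f := fun y => coord j (j + 2) (pt (chart_vec i w y)))).
(* The image of the overlap is a neighborhood of [t]: the inverse chart is continuous and the domain
   of the other chart is open. *)
- have n1 : \forall y \near toC t, 0 < re (1 + y ^+ m) by exact: near_cod.
  have n2 : \forall y \near toC t, chart_dom j w' (pt (chart_vec i w y)).
    exact: (cts_near (chart_inv_cts hw ht) (near_dom hw' hj)).
  have n3 : \forall y \near toC t, A (ofC y).
    near=> y.
    have cy : chart_cod (ofC y) by rewrite /chart_cod /= ofCK; near: y.
    exists (chart_inv i w (ofC y)); last by have [] := chart_inv_dom i hw cy.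
    split; first by have [] := chart_inv_dom i hw cy.
    by rewrite /chart_inv ofCK; near: y.
  have := cts_near (@toC_continuous R t) n3.
  by apply: filterS => q; rewrite toCK.
- move=> q /AE[hq [hq' _]].
  apply: (cts_comp (f := coord j (j + 2))); first exact: chart_inv_cts.
  exact: coord_cts.
- exact: (chart_transition_cdiff hw hw' ht hj).
Unshelve. all: by end_near.
Qed.

End Charts.

(** * Faces *)

Lemma homeomorphism_sym (T U : topologicalType) (A : set T) (B : set U) f g :
  homeomorphism A B f g -> homeomorphism B A g f.
Proof.
move=> [fAB gf fc gc]; split=> //.
- rewrite -fAB; apply/seteqP; split=> [_ [_ [x Ax <-] <-]|x Ax]; first by rewrite gf.
  by exists (f x); [exists x | exact: gf].
- by rewrite -fAB => _ [x Ax <-]; rewrite gf.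
Qed.

Section Faces.
Variables (R : realType) (N : nat).
Hypothesis N0 : (0 < N)%N.
Local Notation C := (Cx R).
Local Notation vec := ('I_3 -> C).
Local Notation m := (2 * N)%N.
Hypothesis m0 : (0 < m)%N.
Local Notation pt := (pt m0).
Implicit Types (d z w : C) (b : nat) (r : R).

Definition vec3 z0 z1 z2 : vec := fun k =>
  if k == 0 then z0 else if k == 1 then z1 else z2.

Lemma on_vec3 z0 z1 z2 : [\/ z0 != 0, z1 != 0 | z2 != 0] ->
  z0 ^+ m + z1 ^+ m + z2 ^+ m = 0 -> on_fermat m (vec3 z0 z1 z2).
Proof.
move=> hn hs; split.
  by case: hn; [exists 0 | exists 1 | exists 2].
by rewrite (sum_ord3 _ 0) !add0r.
Qed.

Lemma vec3_cts (T : topologicalType) (f0 f1 f2 : T -> C) x :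
  continuous_at x f0 -> continuous_at x f1 -> continuous_at x f2 ->
  forall k, continuous_at x (fun y => vec3 (f0 y) (f1 y) (f2 y) k).
Proof.
move=> h0 h1 h2 k; rewrite /vec3; have [_|_] := eqVneq k 0; first exact: h0.
by have [_|_] := eqVneq k 1; [exact: h1 | exact: h2].
Qed.

(** The unit circle with circumference 2m: a unit step is one edge of a face boundary. Even integers
    give the m-th roots of 1, odd integers those of -1. *)
Definition epi r : C := expi (pi * r / m%:R).

Lemma m_neq0 : m%:R != 0 :> R. Proof. by rewrite pnatr_eq0 -lt0n. Qed.
Lemma epiD r r' : epi (r + r') = epi r * epi r'.
Proof. by rewrite /epi mulrDr mulrDl expiD. Qed.
Lemma epi_0 : epi 0 = 1. Proof. by rewrite /epi mulr0 mul0r expi0. Qed.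
Lemma epi_neq0 r : epi r != 0. Proof. exact: expi_neq0. Qed.
Lemma epiN r : epi (- r) = (epi r)^-1. Proof. by rewrite /epi mulrN mulNr expiN. Qed.
Lemma epiXm r : epi r ^+ m = expi (pi * r).
Proof. by rewrite expiX mulrC divfK // m_neq0. Qed.
Lemma epiX r k : epi r ^+ k = epi (k%:R * r).
Proof. by rewrite expiX /epi; congr expi; rewrite mulrA; congr (_ / _); ring. Qed.
Lemma expi_2nat1 k : expi (pi * (2 * k%:R)) = 1 :> C.
Proof.
have -> : pi * (2 * k%:R) = k%:R * (pi + pi) :> R by ring.
by rewrite -expiX expiD expi_pi mulrNN mulr1 expr1n.
Qed.
Lemma epi1m : epi 1 ^+ m = -1. Proof. by rewrite epiXm mulr1 expi_pi. Qed.

Lemma expr_double (z : C) : z ^+ m = (z ^+ N) ^+ 2.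
Proof. by rewrite -exprM mulnC. Qed.

Definition face_twist b : C := epi (1 - 2 * b%:R).

Lemma face_twistm b : face_twist b ^+ m = -1.
Proof. by rewrite epiXm mulrBr mulr1 expiD expiN expi_2nat1 expi_pi invr1 mulr1. Qed.
Lemma face_twist_neq0 b : face_twist b != 0. Proof. exact: epi_neq0. Qed.

Definition nroot2 : R := 2 `^ N%:R^-1.

Lemma nroot2_gt0 : 0 < nroot2. Proof. exact: powR_gt0. Qed.
Lemma nroot2m : nroot2 ^+ m = 4.
Proof. by rewrite mulnC exprM rootXK //; ring. Qed.

(** With D = d^m, the m-th powers of the coordinates are (1+D)^2, -(1-D)^2 and -4D, whose sum is 0.
    The factor [nroot2] is the positive m-th root of 4, and [epi 1] is an m-th root of -1. *)
Definition face_vec b d : vec :=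
  vec3 (rho N (1 + d ^+ m)) (face_twist b * rho N (1 - d ^+ m)) (rc nroot2 * epi 1 * d).

Lemma face_vecE b d : [/\ face_vec b d 0 = rho N (1 + d ^+ m),
  face_vec b d 1 = face_twist b * rho N (1 - d ^+ m) & face_vec b d 2 = rc nroot2 * epi 1 * d].
Proof. by []. Qed.

Definition face_map b (p : R * R) : fermat R m := pt (face_vec b (toC p)).

(** On the face, the N-th power of x/y times the twist is the Cayley transform L = (1+D)/(1-D), so
    that 1 - D = 2/(L+1). This recovers the second coordinate of [face_vec], and then d from z/y. *)
Definition face_inv b (p : fermat R m) : R * R :=
  ofC (coord 2 1 p * face_twist b * rho N (2 / ((coord 0 1 p * face_twist b) ^+ N + 1)) /
    (rc nroot2 * epi 1)).

Definition face_set b : set (fermat R m) :=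
  [set p | nz 1 p /\ sector N (coord 0 1 p * face_twist b)].

(** Translated by 1, the closed unit disc meets the imaginary axis only at 0, so [rho] is continuous
    at all points needed for the closed face. *)
Lemma closed_half z : nm z <= 1 -> 0 < re (1 + z) \/ 1 + z = 0.
Proof.
move=> hz; have := le_trans (re_le_nm z) hz; rewrite ler_norml => /andP[h _].
have [h1|h1] := ltP 0 (re (1 + z)); [by left|right].
have hr : re z = -1 by move: h1; rewrite !cE; lra.
have : nm z ^+ 2 <= 1 by rewrite expr_le1 // nm_ge0.
rewrite nm2 hr sqrrN expr1n gerDl => hi.
have : im z = 0 by apply/eqP; rewrite -sqrf_eq0 eq_le hi sqr_ge0.
by move=> hi'; apply: eqC; rewrite !cE ?hr ?hi'; ring.
Qed.

Lemma open_half z : nm z < 1 -> 0 < re (1 + z).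
Proof.
move=> hz; have := le_lt_trans (re_le_nm z) hz.
by rewrite ltr_norml !cE; lra.
Qed.

Lemma rhoK0 z : 0 < re z \/ z = 0 -> rho N z ^+ N = z.
Proof.
by move=> [h|->]; [exact: rhoK | rewrite rho0 // expr0n gtn_eqF].
Qed.

Lemma nmX_le1 d : nm d <= 1 -> nm (d ^+ m) <= 1.
Proof. by move=> h; rewrite nmX exprn_ile1 // nm_ge0. Qed.

Lemma face_vec_on b d : nm d <= 1 -> on_fermat m (face_vec b d).
Proof.
move=> /nmX_le1 hd.
have h1 := closed_half hd.
have h2 : 0 < re (1 - d ^+ m) \/ 1 - d ^+ m = 0 by apply: closed_half; rewrite nmN.
have r1 := rhoK0 h1; have r2 := rhoK0 h2.
apply: on_vec3.
  (* The first two coordinates cannot both vanish, since (1+D) + (1-D) = 2. *)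
  have [E|E] := eqVneq (1 + d ^+ m) 0.
    constructor 2; apply: mulf_neq0; first exact: face_twist_neq0.
    apply/eqP => r0; move: r2; rewrite r0 expr0n gtn_eqF // => /esym E2.
    have /eqP := congr2 +%R E E2.
    rewrite addrACA subrr !addr0 -[1 + 1]/(2%:R) pnatr_eq0 //.
  constructor 1; apply: contra E => /eqP r0; apply/eqP.
  by rewrite -r1 r0 expr0n gtn_eqF.
have r1' : rho N (1 + d ^+ m) ^+ m = (1 + d ^+ m) ^+ 2 by rewrite (expr_double (rho N _)) r1.
have r2' : rho N (1 - d ^+ m) ^+ m = (1 - d ^+ m) ^+ 2 by rewrite (expr_double (rho N _)) r2.
rewrite r1' (exprMn _ (face_twist b)) r2' face_twistm !exprMn -rcX nroot2m epi1m rmorph_nat.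
by move: (d ^+ m) => a; ring.
Qed.

Lemma closed_discE (p : R * R) : @closed_disc R p -> nm (toC p) <= 1.
Proof.
by rewrite /closed_disc /= => h; rewrite -(expr_le1 (n := 2)) ?nm_ge0 // nm2.
Qed.

Lemma open_discE (p : R * R) : @open_disc R p <-> nm (toC p) < 1.
Proof.
have E : nm (toC p) ^+ 2 = p.1 ^+ 2 + p.2 ^+ 2 := nm2 (toC p).
by rewrite /open_disc /= -E expr_lt1 ?nm_ge0.
Qed.

Lemma face_vec_cts b d : nm d <= 1 ->
  forall k, continuous_at d (fun z => face_vec b z k).
Proof.
move=> /nmX_le1 hd.
have dc : continuous_at d (fun z : C => z ^+ m) by apply: ctsX; exact: cts_id.
apply: vec3_cts.
- apply: (cts_comp (f := rho N)).
    by apply: ctsD; [exact: cts_cst | exact: dc].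
  by apply: rho_continuous => //; exact: closed_half.
- apply: ctsM; first exact: cts_cst.
  apply: (cts_comp (f := rho N)).
    by apply: ctsD; [exact: cts_cst | apply: ctsN; exact: dc].
  by apply: rho_continuous => //; apply: closed_half; rewrite nmN.
- by apply: ctsM; [exact: cts_cst | exact: cts_id].
Qed.

Lemma face_map_cts b : {within @closed_disc R, continuous (face_map b)}.
Proof.
apply: (within_pt (v := fun p => face_vec b (toC p))).
  by move=> p /closed_discE hp; exact: face_vec_on.
move=> p /closed_discE hp k.
by apply: (cts_comp (f := fun z => face_vec b z k)); 
  [exact: toC_continuous | exact: face_vec_cts].
Qed.

Lemma re_cayley z : nm z < 1 -> 0 < re ((1 + z) / (1 - z)).
Proof.
move=> hz; have h := open_half hz.
have h' : 0 < re (1 - z) by apply: open_half; rewrite nmN.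
have n0 : 1 - z != 0 by apply: contraTneq h' => ->; rewrite re0 ltxx.
have p0 : 0 < nm (1 - z) ^+ 2 by rewrite exprn_gt0 // nm_gt0.
rewrite -(pmulr_lgt0 _ p0).
have -> : re ((1 + z) / (1 - z)) * nm (1 - z) ^+ 2 = re ((1 + z) * cj (1 - z)).
  have -> : (1 + z) * cj (1 - z) = (1 + z) / (1 - z) * rc (nm (1 - z) ^+ 2).
    by rewrite -mulcj mulrA divfK.
  by rewrite (reM (_ / _)) imrc mulr0 subr0 rerc.
have : nm z ^+ 2 < 1 by rewrite expr_lt1 // nm_ge0.
rewrite nm2 !cE; move: (re z) (im z) => x y; rewrite !expr2; nra.
Qed.

Lemma face_map_in b d : nm d < 1 ->
  [/\ face_set b (pt (face_vec b d)),
    (coord 0 1 (pt (face_vec b d)) * face_twist b) ^+ N = (1 + d ^+ m) / (1 - d ^+ m) &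
    face_inv b (pt (face_vec b d)) = ofC d].
Proof.
move=> hd; have on := face_vec_on b (ltW hd).
have hD : nm (d ^+ m) < 1 by rewrite nmX exprn_ilt1 ?nm_ge0 // -lt0n.
have h1 := open_half hD.
have h2 : 0 < re (1 - d ^+ m) by apply: open_half; rewrite nmN.
have hL := re_cayley hD.
have r2 := sector_neq0 (rho_sector N0 h2).
have [e0 e1 e2] := face_vecE b d.
have n1 : face_vec b d 1 != 0 by rewrite e1; apply: mulf_neq0 => //; exact: face_twist_neq0.
have hc : coord 0 1 (pt (face_vec b d)) * face_twist b = rho N ((1 + d ^+ m) / (1 - d ^+ m)).
  rewrite (coord_pt _ _ _ on) e0 e1 rho_div //.
  have := face_twist_neq0 b; move: (face_twist b) (rho N _) (rho N _) r2 => x y z y0 x0.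
  by field; rewrite x0 y0.
have hp : (coord 0 1 (pt (face_vec b d)) * face_twist b) ^+ N = (1 + d ^+ m) / (1 - d ^+ m).
  by rewrite hc rhoK.
split=> //.
  rewrite /face_set /= nz_pt // hc; split; first exact: n1.
  exact: rho_sector.
rewrite /face_inv hp; congr ofC.
have n2 : 1 - d ^+ m != 0 by apply: contraTneq h2 => ->; rewrite re0 ltxx.
have two0 : (2 : C) != 0 by rewrite pnatr_eq0.
have -> : 2 / ((1 + d ^+ m) / (1 - d ^+ m) + 1) = 1 - d ^+ m.
  move: (d ^+ m) n2 => a a0; field.
  by rewrite a0 /= (_ : 1 + a + (1 - a) = 2) //; ring.
rewrite (coord_pt _ _ _ on) e2 e1.
have c0 : rc nroot2 != 0 by rewrite rc_eq0 gt_eqF // nroot2_gt0.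
have := epi_neq0 1; have := face_twist_neq0 b.
move: (face_twist b) (epi 1) (rc nroot2) (rho N _) r2 c0 => x y z t t0 z0 x0 y0.
by field; rewrite x0 y0 z0 t0.
Qed.

Lemma face_inv_in b p : face_set b p ->
  nm (toC (face_inv b p)) < 1 /\ face_map b (face_inv b p) = p.
Proof.
have [v on ->] := pt_surj m0 p => -[]; rewrite nz_pt // (coord_pt _ _ _ on) => v1 hs.
have v1m : v 1 ^+ m != 0 by rewrite expf_neq0.
rewrite /face_map /face_inv !(coord_pt _ _ _ on) ofCK.
set s := v 0 / v 1 * face_twist b in hs *; set L := s ^+ N.
set d := v 2 / v 1 * _ * _ / _.
have hL : 0 < re L by exact: sector_re.
have hL1 : 0 < re (L + 1) by rewrite !cE; lra.
have L1 : L + 1 != 0 by apply: contraTneq hL1 => ->; rewrite re0 ltxx.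
pose w := (L - 1) / (L + 1).
have two0 : (2 : C) != 0 by rewrite pnatr_eq0.
have e1w : 1 - w = 2 / (L + 1) by rewrite /w; move: (L) L1 => a a0; field.
have nw : nm w < 1.
  rewrite nmM nmV ltr_pdivrMr ?nm_gt0 // mul1r.
  rewrite -(ltr_pXn2r (ltn0Sn 1)) ?nnegrE ?nm_ge0 // !nm2 !cE.
  by rewrite !expr2; lra.
have h1w : 0 < re (1 - w) by apply: open_half; rewrite nmN.
have c0 : rc nroot2 != 0 by rewrite rc_eq0 gt_eqF // nroot2_gt0.
(* The equation of the curve gives (z/y)^m = L^2 - 1; multiplying by -1 (the twist) and by (1-w)^2 =
   4/(L+1)^2, and dividing by -4, leaves (L-1)/(L+1). *)
have dm : d ^+ m = w.
  have hk : (rc nroot2 * epi 1) ^+ m = - 4.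
    by rewrite exprMn -rcX nroot2m epi1m rmorph_nat mulrN1.
  have hz : v 2 ^+ m / v 1 ^+ m = L ^+ 2 - 1.
    have -> : L ^+ 2 = - (v 0 ^+ m / v 1 ^+ m).
      by rewrite -exprM mulnC exprMn face_twistm mulrN1 expr_div_n.
    have [_ ] := on; rewrite (sum_ord3 _ 0) !add0r => h.
    apply: (mulIf v1m); rewrite divfK // mulrDl mulNr divfK // mulN1r.
    by apply/eqP; rewrite -opprD -addr_eq0 addrC h.
  rewrite /d -e1w expr_div_n hk 2!exprMn face_twistm (expr_double (rho N _)) rhoK //.
  rewrite expr_div_n hz e1w /w; move: (L) L1 => a a0; field.
  by rewrite a0.
have nd : nm d < 1.
  rewrite ltNge; apply/negP => h; have : nm (d ^+ m) < 1 by rewrite dm.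
  by rewrite nmX ltNge exprn_ege1.
split=> //.
have h1 : 0 < re (1 + w) by exact: open_half.
have r2 := sector_neq0 (rho_sector N0 h1w).
have B0 := face_twist_neq0 b.
apply: (@pt_eq _ _ m0 _ _ 1) => //.
  by have [_ -> _] := face_vecE b d; rewrite dm; apply: mulf_neq0.
have hcay : (1 + w) / (1 - w) = L.
  rewrite e1w /w; move: (L) L1 => a a0; field.
  by rewrite a0.
have hs' : rho N (1 + w) / rho N (1 - w) = s.
  by rewrite -rho_div ?hcay // sectorK.
have [e0 e1 e2] := face_vecE b d; rewrite dm in e0 e1.
move=> k; case: (ord3P 0 k) => ->; rewrite ?add0r.
- rewrite e0 e1 invfM mulrCA hs' /s.
  move: (v 0 / v 1) B0 => x B0; by rewrite mulrC mulfK.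
- by rewrite !divff // e1; apply: mulf_neq0.
- rewrite e1 e2 /d -e1w.
  have := epi_neq0 1.
  move: (v 2 / v 1) (face_twist b) (rho N _) (epi 1) (rc nroot2) B0 r2 c0 => x y z t u y0 z0 u0 t0.
  by field; rewrite y0 z0 u0 t0.
Qed.

Lemma face_homeo b :
  homeomorphism (@open_disc R) (face_set b) (face_map b) (face_inv b).
Proof.
split.
- apply/seteqP; split=> [_ [p /open_discE hp <-]|p hp].
    by have [] := face_map_in b hp.
  have [h1 h2] := face_inv_in hp.
  by exists (face_inv b p) => //; apply/open_discE.
- by move=> p /open_discE hp; have [_ _ h] := face_map_in b hp; rewrite h toCK.
- apply: continuous_subspaceW (@face_map_cts b) => p /open_discE/ltW hp.
  by rewrite /closed_disc /= -[X in X <= _](nm2 (toC p)) expr_le1 // nm_ge0.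
- apply: continuous_in_subspaceT => p /set_mem[h1 h2].
  apply: (cts_comp (f := @ofC R)); last exact: ofC_continuous.
  have c0 : continuous_at p (coord 0 1) by exact: coord_cts.
  have c2c : continuous_at p (coord 2 1) by exact: coord_cts.
  have hL := sector_re N0 h2.
  have hL1 : 0 < re ((coord 0 1 p * face_twist b) ^+ N + 1) by rewrite reD re1; lra.
  have L1 : (coord 0 1 p * face_twist b) ^+ N + 1 != 0.
    by apply: contraTneq hL1 => ->; rewrite re0 ltxx.
  apply: ctsM; last exact: cts_cst.
  apply: ctsM; first by apply: ctsM; [exact: c2c | exact: cts_cst].
  apply: (cts_comp (f := rho N)).
    apply: ctsM; first exact: cts_cst.
    apply: ctsV; first exact: L1.
    apply: ctsD; last exact: cts_cst.
    by apply: ctsX; apply: ctsM; [exact: c0 | exact: cts_cst].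
  apply: rho_continuous => //; left.
  move: L1 hL1; move: (_ + 1) => z z0 hz.
  have p0 : 0 < nm z ^+ 2 by rewrite exprn_gt0 // nm_gt0.
  rewrite -(pmulr_lgt0 _ p0).
  have -> : re (2 / z) * nm z ^+ 2 = re (2 * cj z).
    have -> : 2 * cj z = 2 / z * rc (nm z ^+ 2) by rewrite -mulcj mulrA divfK.
    by rewrite (reM (_ / _)) imrc mulr0 subr0 rerc.
  by rewrite mulr_natl mulr2n !cE; lra.
Qed.

End Faces.

(** * Edges *)

Section Edges.
Variables (R : realType) (N : nat).
Hypothesis N0 : (0 < N)%N.
Local Notation C := (Cx R).
Local Notation vec := ('I_3 -> C).
Local Notation m := (2 * N)%N.
Hypothesis m0 : (0 < m)%N.
Local Notation pt := (pt m0).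
Local Notation e := (@epi R N).
Implicit Types (z w : C) (b i j q : nat) (r s t : R).

(** * Roots of 1 and -1 *)

Lemma epi_eq1 r : `|r| < 2 * m%:R -> e r = 1 -> r = 0.
Proof.
move=> hr /expi_eq1 h; have mR : 0 < m%:R :> R by rewrite ltr0n.
have : pi * r / m%:R = 0.
  apply: h; rewrite !normrM normfV (ger0_norm (pi_ge0 R)) (gtr0_norm mR).
  by rewrite ltr_pdivrMr // -mulrA mulrCA ltr_pM2l ?pi_gt0.
move/eqP; rewrite !mulf_eq0 invr_eq0 (gt_eqF mR) orbF (gt_eqF (pi_gt0 R)) /=.
by move/eqP.
Qed.

Lemma epi_inj i j : (i < m)%N -> (j < m)%N ->
  e (- (2 * i%:R)) = e (- (2 * j%:R)) -> i = j.
Proof.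
move=> hi hj E; have E1 : e (2 * (j%:R - i%:R)) = 1.
  have -> : 2 * (j%:R - i%:R) = - (2 * i%:R) - (- (2 * j%:R)) :> R by ring.
  by rewrite epiD E -epiD subrr epi_0.
have iR : i%:R < m%:R :> R by rewrite ltr_nat.
have jR : j%:R < m%:R :> R by rewrite ltr_nat.
have i0 : 0 <= i%:R :> R by rewrite ler0n.
have j0 : 0 <= j%:R :> R by rewrite ler0n.
have : 2 * (j%:R - i%:R) = 0 :> R.
  by apply: epi_eq1 E1; rewrite ltr_norml; apply/andP; split; lra.
by move=> h; apply/eqP; rewrite -(eqr_nat R); apply/eqP; lra.
Qed.

Lemma epiN2m k : e (- (2 * k%:R)) ^+ m = 1.
Proof. by rewrite epiXm // mulrN expiN expi_2nat1 invr1. Qed.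

Lemma epi_prim : m.-primitive_root (e (- 2)).
Proof.
have eE k : e (- 2) ^+ k = e (- (2 * k%:R)) by rewrite epiX mulrN mulrC.
apply/andP; split=> //; apply/forallP => k; apply/eqP.
rewrite unity_rootE eE; apply/eqP/eqP => [h|->]; last first.
  by rewrite -eE epiXm // mulrN expiN -[2]mulr1 (expi_2nat1 R 1) invr1.
have := ltn_ord k; rewrite leq_eqVlt => /predU1P[//|lt].
suff : k.+1 = 0%N by [].
by apply: epi_inj; rewrite // h mulr0 oppr0 epi_0.
Qed.

Lemma unity_rootP z : z ^+ m = 1 ->
  exists2 i, (i < m)%N & z = e (- (2 * i%:R)).
Proof.
move=> /(prim_rootP epi_prim)[i ->]; exists i; first exact: ltn_ord.
by rewrite epiX mulrN mulrC.
Qed.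

Lemma unity_root_ge0 z r : 0 <= r -> z ^+ m = rc r ^+ m ->
  exists2 i, (i < m)%N & z = e (- (2 * i%:R)) * rc r.
Proof.
move=> r0; have [->|rn] := eqVneq r 0.
  rewrite rmorph0 expr0n gtn_eqF // => /eqP; rewrite expf_eq0 m0 /= => /eqP ->.
  by exists 0%N; rewrite ?mulr0.
have rc0 : rc r != 0 by rewrite rc_eq0.
move=> h; have /unity_rootP[i hi E] : (z / rc r) ^+ m = 1.
  by rewrite expr_div_n h divff // expf_neq0.
by exists i => //; rewrite -E divfK.
Qed.

Lemma unity_root_opp z : z ^+ m = -1 -> exists2 b, (b < m)%N & z = face_twist R N b.
Proof.
move=> h; have /unity_rootP[b hb E] : (z / e 1) ^+ m = 1.
  by rewrite expr_div_n h epi1m // divff // oppr_eq0 oner_neq0.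
by exists b => //; rewrite /face_twist epiD -E mulrC divfK // epi_neq0.
Qed.

(* At [w = expi (pi * t)], the function [(1 + w) ^ 2 / 4 w] takes the value
   [1 - alpha t ^+ m]. *)
Definition alpha t : R := `|sin (pi / 2 * t)| `^ N%:R^-1.

Lemma alpha_ge0 t : 0 <= alpha t. Proof. exact: powR_ge0. Qed.

Lemma alpha0 : alpha 0 = 0.
Proof.
by rewrite /alpha mulr0 sin0 normr0 powR0 // invr_eq0 pnatr_eq0 -lt0n.
Qed.

Lemma alphaN t : alpha t ^+ N = `|sin (pi / 2 * t)|.
Proof. by rewrite rootXK. Qed.

Lemma alpham t : alpha t ^+ m = sin (pi / 2 * t) ^+ 2.
Proof. by rewrite mulnC exprM alphaN real_normK ?num_real. Qed.

Lemma sin_opp t : sin (pi / 2 * (1 - t)) = cos (pi / 2 * t).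
Proof. by rewrite mulrBr mulr1 -opprB sinN sinBpihalf opprK. Qed.

Lemma alpha_sum t : alpha (1 - t) ^+ m + alpha t ^+ m = 1.
Proof. by rewrite !alpham sin_opp cos2Dsin2. Qed.

Lemma pihalf_itv t : 0 <= t <= 1 -> 0 <= pi / 2 * t <= pi / 2.
Proof.
move=> /andP[t0 t1]; have p0 : 0 <= pi / 2 :> R by rewrite divr_ge0 ?pi_ge0.
by rewrite mulr_ge0 //= ler_piMr.
Qed.

Lemma sin_itv t : 0 <= t <= 1 -> 0 <= sin (pi / 2 * t).
Proof.
move=> /pihalf_itv/andP[h1 h2]; apply: sin_ge0_pi; rewrite h1 /=.
by have := pi_ge0 R; lra.
Qed.

Lemma alpha_inj : {in `[0, 1] &, injective alpha}.
Proof.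
move=> s t; rewrite !in_itv /= => hs ht E.
have : sin (pi / 2 * s) = sin (pi / 2 * t).
  by rewrite -[LHS]ger0_norm ?sin_itv // -[RHS]ger0_norm ?sin_itv // -!alphaN E.
have hp := pi_gt0 R.
move=> /(@sin_inj R (pi / 2 * s) (pi / 2 * t)); rewrite !in_itv /=.
have /andP[s0 s1] := pihalf_itv hs; have /andP[t0 t1] := pihalf_itv ht.
move=> h; apply: (mulfI (x := pi / 2)); first by rewrite gt_eqF // divr_gt0.
by apply: h; apply/andP; split; lra.
Qed.

Lemma alpha_eq0 t : 0 <= t <= 1 -> alpha t = 0 -> t = 0.
Proof.
by move=> ht h; apply: alpha_inj; rewrite ?alpha0 // in_itv //= lexx ler01.
Qed.

Lemma alpha_continuous : continuous alpha.
Proof.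
move=> t.
have c1 : continuous_at t (fun t => rc (sin (pi / 2 * t))).
  apply: (cts_comp (f := @rc R)); last exact: rc_continuous.
  apply: (cts_comp (f := @sin R)); last exact: continuous_sin.
  by apply: ctsM; [exact: cts_cst | exact: cts_id].
(* Writing [alpha] as the modulus of a value of [rho] transfers the continuity of [rho] at 0, where
   the sine vanishes. *)
have alphaE y : alpha y = nm (rho N (rc `|sin (pi / 2 * y)|)).
  by rewrite /rho nmM nm_expi mulr1 !nm_rc normr_id ger0_norm // powR_ge0.
have -> : alpha = fun y => nm (rho N (rc `|sin (pi / 2 * y)|)) by apply: funext.
apply: (cts_comp (f := @nm R)); last exact: nm_continuous.
apply: (cts_comp (f := rho N)).
  apply: (cts_comp (f := @rc R)); last exact: rc_continuous.
  apply: (cts_comp (f := fun x : R => `|x|)); last exact: norm_continuous.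
  apply: (cts_comp (f := @sin R)); last exact: continuous_sin.
  by apply: ctsM; [exact: cts_cst | exact: cts_id].
apply: rho_continuous => //; rewrite rerc.
have [->|h] := eqVneq (sin (pi / 2 * t)) 0; first by right; rewrite normr0.
by left; rewrite normr_gt0.
Qed.

(** The m-th powers are the squares of the cosine and the sine of pi s/2, and -1. At s = 0 the index
    [j] disappears and the point is a vertex of part 0; at s = 1 the same happens to [i] and part
    1. *)
Definition edge_vec i j s : vec := vec3 (e (- (2 * i%:R)) * rc (alpha (1 - s)))
  (e (- (2 * j%:R)) * rc (alpha s)) (e 1).

Lemma edge_vecE i j s : [/\ edge_vec i j s 0 = e (- (2 * i%:R)) * rc (alpha (1 - s)),
  edge_vec i j s 1 = e (- (2 * j%:R)) * rc (alpha s) & edge_vec i j s 2 = e 1].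
Proof. by []. Qed.

Lemma edge_vec_on i j s : on_fermat m (edge_vec i j s).
Proof.
apply: on_vec3; first by constructor 3; exact: epi_neq0.
rewrite 2!exprMn !epiN2m epi1m // !mul1r -!rcX -rmorphD alpha_sum.
by rewrite rmorph1 subrr.
Qed.

Lemma epi_rc_inj i j r t : (i < m)%N -> (j < m)%N -> 0 <= r -> 0 <= t ->
  e (- (2 * i%:R)) * rc r = e (- (2 * j%:R)) * rc t -> r = t /\ (r != 0 -> i = j).
Proof.
move=> hi hj r0 t0 E; have rt : r = t.
  by have := congr1 (@nm R) E; rewrite !nmM !nm_expi !nm_rc !ger0_norm // !mul1r.
split=> // rn; apply: epi_inj => //.
by apply: (mulIf (x := rc r)); rewrite ?rc_eq0 // E rt.
Qed.

(** The third coordinate is constant, so equal points have equal vectors. Moduli then determine s,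
    and phases determine the index of each nonzero coordinate. *)
Lemma pt_edge_inj i j s i' j' s' :
  (i < m)%N -> (j < m)%N -> (i' < m)%N -> (j' < m)%N ->
  0 <= s <= 1 -> 0 <= s' <= 1 ->
  pt (edge_vec i j s) = pt (edge_vec i' j' s') ->
  [/\ s = s', s != 1 -> i = i' & s != 0 -> j = j'].
Proof.
move=> hi hj hi' hj' hs hs' E.
have on := edge_vec_on i j s; have on' := edge_vec_on i' j' s'.
have [a0 a1 a2] := edge_vecE i j s; have [b0 b1 b2] := edge_vecE i' j' s'.
have K k : edge_vec i j s k = edge_vec i' j' s' k.
  have h := etrans (esym (coord_pt m0 k 2 on))
    (etrans (congr1 (coord k 2) E) (coord_pt m0 k 2 on')).
  by move: h; rewrite a2 b2; apply: mulIf; rewrite invr_eq0 epi_neq0.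
have := K 0; have := K 1; rewrite a0 a1 b0 b1 {E on on' K a0 a1 a2 b0 b1 b2}.
move=> /(epi_rc_inj hj hj' (alpha_ge0 _) (alpha_ge0 _))[E1 E2].
move=> /(epi_rc_inj hi hi' (alpha_ge0 _) (alpha_ge0 _))[_ E4].
split.
- by apply: alpha_inj; rewrite ?in_itv.
- move=> s1; apply: E4; apply: contra s1 => /eqP h.
  have : 1 - s = 0 by apply: alpha_eq0 h; lra.
  by move=> h'; apply/eqP; lra.
- by move=> s0; apply: E2; apply: contra s0 => /eqP/alpha_eq0 ->.
Qed.

(* On the graph [(v_0 / v_1) ^+ m] is a nonnegative real number, whereas on a
   face its opposite is the square of a number with positive real part. *)
Lemma edge_not_face b i j s : ~ face_set b (pt (edge_vec i j s)).
Proof.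
have on := edge_vec_on i j s; have [a0 a1 _] := edge_vecE i j s.
move=> -[_ /(sector_re N0)]; rewrite (coord_pt _ _ _ on) a0 a1.
set L := _ ^+ N => hL.
have L2 : L ^+ 2 = rc (- ((alpha (1 - s) / alpha s) ^+ m)).
  rewrite /L -expr_double exprMn face_twistm // mulrN1 expr_div_n 2!exprMn !epiN2m !mul1r.
  by rewrite rcN expr_div_n rcM rcV !rcX.
have r0 : 0 <= (alpha (1 - s) / alpha s) ^+ m.
  by rewrite exprn_ge0 // divr_ge0 // alpha_ge0.
have := congr1 (@re R) L2; have := congr1 (@im R) L2.
rewrite rerc imrc expr2 !cE; move: (re L) (im L) hL => x y x0 h1 h2.
have y0 : y = 0.
  have : x * y = 0 by lra.
  by move/eqP; rewrite mulf_eq0 gt_eqF //= => /eqP.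
by move: h2; rewrite y0; nra.
Qed.

(** For y nonzero, let L be the N-th power of x/y times a twist, so that L^2 = -(x/y)^m. If L is not
    imaginary, L or -L has positive real part, and its principal root divided by x/y is an m-th root
    of -1, hence the twist of a face. If L is imaginary, (x/y)^m is a nonnegative real and the point
    is on an edge. The points with y = 0 are the vertices of part 0. *)
Lemma face_or_edge p : (exists2 b, (b < m)%N & face_set b p) \/
  exists i j s, [/\ (i < m)%N, (j < m)%N, 0 <= s <= 1 & p = pt (edge_vec i j s)].
Proof.
have [v on ->] := pt_surj m0 p; have [hn] := on.
rewrite (sum_ord3 _ 0) !add0r => hsum.
have e10 := @epi_neq0 R N 1.
have toedge i j s : (i < m)%N -> (j < m)%N -> 0 <= s <= 1 -> v 2 != 0 ->
    v 0 / v 2 * e 1 = e (- (2 * i%:R)) * rc (alpha (1 - s)) ->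
    v 1 / v 2 * e 1 = e (- (2 * j%:R)) * rc (alpha s) ->
    exists i j s, [/\ (i < m)%N, (j < m)%N, 0 <= s <= 1 & pt v = pt (edge_vec i j s)].
  move=> hi hj hs v2 h0 h1; exists i, j, s; split=> //.
  have [a0 a1 a2] := edge_vecE i j s.
  apply: (@pt_eq _ _ m0 _ _ 2) => [//||k]; first by rewrite a2.
  case: (ord3P 0 k) => ->; rewrite ?add0r a2.
  - by rewrite a0 -h0 mulfK.
  - by rewrite a1 -h1 mulfK.
  - by rewrite !divff.
have [v1|v1] := eqVneq (v 1) 0.
  right; have v1m : v 1 ^+ m = 0 by rewrite v1 expr0n gtn_eqF.
  move: hsum; rewrite v1m addr0 => h02.
  have v2 : v 2 != 0.
    apply/eqP => v2; case: hn => k; case: (ord3P 0 k) => ->; rewrite ?add0r.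
    - move: h02; rewrite v2 expr0n gtn_eqF // addr0 => /eqP.
      by rewrite expf_eq0 m0 /= => ->.
    - by rewrite v1 eqxx.
    - by rewrite v2 eqxx.
  have v2m : v 2 ^+ m != 0 by rewrite expf_neq0.
  have a1 : alpha (1 - 0) = 1.
    have := alpha_sum 0; rewrite alpha0 expr0n gtn_eqF // addr0 => h.
    by apply/eqP; rewrite -(eqrXn2 m0) ?alpha_ge0 // h expr1n.
  have : (v 0 / v 2 * e 1) ^+ m = rc (alpha (1 - 0)) ^+ m.
    rewrite a1 rmorph1 expr1n exprMn expr_div_n epi1m // mulrN1.
    apply: (mulIf v2m); rewrite mulNr divfK // mul1r.
    by apply/eqP; rewrite eq_sym -addr_eq0 addrC h02.
  move=> /(unity_root_ge0 (alpha_ge0 _))[i hi hx].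
  apply: (toedge i 0%N 0) => //; first by rewrite lexx ler01.
  by rewrite v1 alpha0 !mul0r rmorph0 mulr0.
have v1m : v 1 ^+ m != 0 by rewrite expf_neq0.
pose L := (v 0 / v 1 * face_twist R N 0) ^+ N.
have L2 : L ^+ 2 = - (v 0 / v 1) ^+ m by rewrite /L -expr_double exprMn face_twistm // mulrN1.
have face L' : 0 < re L' -> L' ^+ 2 = - (v 0 / v 1) ^+ m ->
    exists2 b, (b < m)%N & face_set b (pt v).
  move=> hL' E.
  have L'0 : L' != 0 by apply: contraTneq hL' => ->; rewrite re0 ltxx.
  have c0 : v 0 / v 1 != 0.
    apply: contra L'0 => /eqP c0; move/eqP: E.
    by rewrite c0 expr0n gtn_eqF // oppr0 expf_eq0.
  have : (rho N L' / (v 0 / v 1)) ^+ m = -1.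
    rewrite expr_div_n expr_double rhoK // E mulNr divff // expf_neq0 //.
  move=> /unity_root_opp[b hb Eb]; exists b => //; split; first by rewrite nz_pt.
  by rewrite (coord_pt _ _ _ on) -Eb mulrC divfK //; exact: rho_sector.
have [h|h|h] := ltgtP (re L) 0.
- by left; apply: (face (- L)); rewrite ?reN ?oppr_gt0 // sqrrN.
- by left; exact: (face L).
right; pose r := im L ^+ 2; have r0 : 0 <= r by exact: sqr_ge0.
have E : (v 0 / v 1) ^+ m = rc r.
  by rewrite -[LHS]opprK -L2 /r !expr2; apply: eqC; rewrite !cE h; ring.
have r1 : 0 < 1 + r by lra.
have h2 : v 2 ^+ m = - (v 1 ^+ m * rc (1 + r)).
  have -> : rc (1 + r) = 1 + rc r := rmorphD (@rc R) 1 r.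
  rewrite -E expr_div_n mulrDr mulr1 mulrCA divff // mulr1.
  by apply/eqP; rewrite -addr_eq0 addrC [v 1 ^+ m + _]addrC hsum.
have v2m : v 2 ^+ m != 0.
  by rewrite h2 oppr_eq0 mulf_neq0 // rc_eq0 gt_eqF.
have v2 : v 2 != 0 by move: v2m; rewrite expf_eq0 m0.
(* The parameter is read off from (y/z)^m = -1/(1+r): on an edge this is minus the square of sin(pi
   s/2). *)
pose s := asin (Num.sqrt (1 + r)^-1) / (pi / 2).
have sq0 : 0 <= Num.sqrt (1 + r)^-1 by exact: sqrtr_ge0.
have sq1 : Num.sqrt (1 + r)^-1 <= 1.
  by rewrite -[leRHS]sqrtr1 ler_wsqrtr // invf_le1 //; lra.
have sqN : -1 <= Num.sqrt (1 + r)^-1 <= 1 by rewrite sq1 andbT; lra.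
have p0 : 0 < pi / 2 :> R by rewrite divr_gt0 ?pi_gt0.
have sE : pi / 2 * s = asin (Num.sqrt (1 + r)^-1).
  by rewrite /s mulrC divfK // gt_eqF.
have hs : 0 <= s <= 1.
  rewrite /s ler_pdivrMr // mul1r asin_lepi2 // andbT divr_ge0 ?(ltW p0) //.
  rewrite leNgt; apply/negP => lt0.
  have := asinK (x := Num.sqrt (1 + r)^-1); rewrite in_itv /= sqN => /(_ isT) K.
  have : 0 < sin (- asin (Num.sqrt (1 + r)^-1)).
    apply: sin_gt0_pi; rewrite oppr_gt0 lt0 /=.
    by have := asin_geNpi2 sqN; have := pi_gt0 R; lra.
  by rewrite sinN K oppr_gt0 ltNge sq0.
have as1 : alpha s ^+ m = (1 + r)^-1.
  by rewrite alpham sE asinK ?in_itv //= sqr_sqrtr // invr_ge0 ltW.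
have as2 : alpha (1 - s) ^+ m = r / (1 + r).
  have := alpha_sum s; rewrite as1 => hsum'.
  have -> : alpha (1 - s) ^+ m = 1 - (1 + r)^-1 by lra.
  by field; rewrite gt_eqF.
have rr0 : rc (1 + r) != 0 by rewrite rc_eq0 gt_eqF.
have h12 : v 1 ^+ m / v 2 ^+ m = - (rc (1 + r))^-1.
  rewrite h2; move: (v 1 ^+ m) (rc (1 + r)) v1m rr0 => x y x0 y0.
  by field; rewrite x0 y0.
have : (v 1 / v 2 * e 1) ^+ m = rc (alpha s) ^+ m.
  rewrite -rcX as1 fmorphV exprMn epi1m // mulrN1 expr_div_n h12.
  by rewrite opprK.
move=> /(unity_root_ge0 (alpha_ge0 _))[j hj hy].
have : (v 0 / v 2 * e 1) ^+ m = rc (alpha (1 - s)) ^+ m.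
  rewrite -rcX as2 rcM fmorphV exprMn epi1m // mulrN1 expr_div_n.
  have -> : v 0 ^+ m = rc r * v 1 ^+ m by rewrite -E expr_div_n divfK.
  by rewrite -mulrA h12 mulrN opprK.
move=> /(unity_root_ge0 (alpha_ge0 _))[i hi hx].
exact: (toedge i j s).
Qed.

(** Twists have equal m-th powers, so the two N-th powers agree up to sign. Both have positive real
    part, hence they are equal, and the N-th power is injective on the sector. *)
Lemma face_set_inj b b' (p : fermat R m) : (b < m)%N -> (b' < m)%N ->
  face_set b p -> face_set b' p -> b = b'.
Proof.
move=> hb hb' [_ h] [_ h']; set c := coord 0 1 p in h h'.
have c0 : c != 0 by have := sector_neq0 h; rewrite mulf_eq0 negb_or => /andP[].
have L2 : ((c * face_twist R N b) ^+ N) ^+ 2 = ((c * face_twist R N b') ^+ N) ^+ 2.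
  by rewrite -!expr_double !exprMn !face_twistm.
have L : (c * face_twist R N b) ^+ N = (c * face_twist R N b') ^+ N.
  have := sector_re N0 h; have := sector_re N0 h'; move/eqP: L2.
  rewrite eqf_sqr => /orP[/eqP //|/eqP -> r1]; rewrite reN oppr_gt0 => r2.
  by have := lt_trans r1 r2; rewrite ltxx.
have : c * face_twist R N b = c * face_twist R N b'.
  by rewrite -(sectorK N0 h) L sectorK.
move=> /(mulfI c0); rewrite /face_twist !epiD => /(mulfI (@epi_neq0 R N 1)).
exact: epi_inj.
Qed.

(** Half-angle formula: 1 + e^(i pi s) = 2 cos(pi s/2) e^(i pi s/2). Together with its companion for
    1 - e^(i pi s), it identifies the boundary values of a face with points of edges. *)
Lemma rho_1Dexpi s : 0 <= s <= 1 ->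
  rho N (1 + expi (pi * s)) = rc (nroot2 R N) * rc (alpha (1 - s)) * e s.
Proof.
move=> hs; have /andP[h0 h1] := pihalf_itv hs.
have hp := pi_gt0 R.
have ch : 0 <= cos (pi / 2 * s) by apply: cos_ge0_pihalf; apply/andP; split; lra.
have -> : 1 + expi (pi * s) = rc (2 * cos (pi / 2 * s)) * expi (pi / 2 * s).
  have -> : pi * s = (pi / 2 * s) *+ 2 by rewrite mulr2n; field.
  apply: eqC; rewrite /expi !cE.
    by rewrite cos_mulr2n; ring.
  by rewrite sin_mulr2n; ring.
(* At s = 1 the angle reaches pi/2, outside the range of [arg], but the modulus is then 0. *)
rewrite rho_polar // ?mulr_ge0 // => [|c0]; last first.
  have s1 : s != 1.
    by apply: contraTneq c0 => ->; rewrite mulr1 cos_pihalf mulr0 ltxx.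
  apply/andP; split; first lra.
  by rewrite gtr_pMr ?divr_gt0 // lt_neqAle s1; case/andP: hs.
rewrite powRM // rcM; congr (rc _ * rc _ * _).
  by rewrite /alpha sin_opp ger0_norm.
by rewrite /epi natrM; congr expi; field; rewrite pnatr_eq0 -lt0n.
Qed.

Lemma rho_1Bexpi s : 0 <= s <= 1 ->
  rho N (1 - expi (pi * s)) = rc (nroot2 R N) * rc (alpha s) * e (s - 1).
Proof.
move=> hs; have /andP[h0 h1] := pihalf_itv hs.
have hp := pi_gt0 R.
have sh := sin_itv hs.
have -> : 1 - expi (pi * s) = rc (2 * sin (pi / 2 * s)) * expi (pi / 2 * s - pi / 2).
  have -> : pi * s = (pi / 2 * s) *+ 2 by rewrite mulr2n; field.
  apply: eqC; rewrite /expi !cE cosBpihalf sinBpihalf.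
    by rewrite cos_mulr2n cos2sin2; ring.
  by rewrite sin_mulr2n; ring.
rewrite rho_polar // ?mulr_ge0 // => [|c0]; last first.
  have s0 : s != 0 by apply: contraTneq c0 => ->; rewrite mulr0 sin0 mulr0 ltxx.
  have : 0 < pi / 2 * s.
    by rewrite mulr_gt0 ?divr_gt0 // lt_neqAle eq_sym s0; case/andP: hs.
  by move=> ?; apply/andP; split; lra.
rewrite powRM // rcM; congr (rc _ * rc _ * _).
  by rewrite /alpha ger0_norm.
by rewrite /epi natrM; congr expi; field; rewrite pnatr_eq0 -lt0n.
Qed.

Lemma expi_2nat q s : expi (pi * (2 * q%:R + s)) = expi (pi * s) :> C.
Proof. by rewrite mulrDr expiD expi_2nat1 mul1r. Qed.

(* The boundary of a face, parametrised by [e] on [0, 2m], alternates between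
   edges run through from part 0 to part 1 and from part 1 to part 0. *)
Lemma face_boundary_even b q s : 0 <= s <= 1 ->
  pt (face_vec N b (e (2 * q%:R + s))) = pt (edge_vec q (b + q) s).
Proof.
(* The two vectors are proportional; the factor is the ratio of their third coordinates. *)
move=> hs; rewrite -(@pt_scale _ _ m0 (rc (nroot2 R N) * e (2 * q%:R + s)) (edge_vec _ _ _));
  last by rewrite mulf_neq0 ?epi_neq0 // rc_eq0 gt_eqF // nroot2_gt0.
congr pt; apply: funext => k.
have [a0 a1 a2] := edge_vecE q (b + q) s.
have [b0 b1 b2] := face_vecE N b (e (2 * q%:R + s)).
case: (ord3P 0 k) => ->; rewrite ?add0r.
- rewrite a0 b0 epiXm // expi_2nat rho_1Dexpi //.
  have -> : e s = e (2 * q%:R + s) * e (- (2 * q%:R)) by rewrite -epiD; congr e; ring.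
  by move: (e _) (e _) (rc _) (rc _) => *; ring.
- rewrite a1 b1 epiXm // expi_2nat rho_1Bexpi // /face_twist.
  have E : e (1 - 2 * b%:R) * e (s - 1) = e (2 * q%:R + s) * e (- (2 * (b + q)%:R)).
    by rewrite -!epiD natrD; congr e; ring.
  rewrite mulrCA E.
  by move: (e _) (e _) (rc _) (rc _) => *; ring.
- rewrite a2 b2.
  by move: (e _) (e _) (rc _) => *; ring.
Qed.

Lemma face_boundary_odd b q s : 0 <= s <= 1 ->
  pt (face_vec N b (e (2 * q%:R + 1 + s))) = pt (edge_vec q.+1 (b + q) (1 - s)).
Proof.
move=> hs; rewrite -(@pt_scale _ _ m0 (rc (nroot2 R N) * e (2 * q%:R + 1 + s)) (edge_vec _ _ _));
  last by rewrite mulf_neq0 ?epi_neq0 // rc_eq0 gt_eqF // nroot2_gt0.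
congr pt; apply: funext => k.
have [a0 a1 a2] := edge_vecE q.+1 (b + q) (1 - s).
have [b0 b1 b2] := face_vecE N b (e (2 * q%:R + 1 + s)).
(* An odd step changes the sign of d^m and so exchanges 1+D and 1-D; this is why the edge is now run
   through backwards. *)
have E0 : expi (pi * (2 * q%:R + 1 + s)) = - expi (pi * s) :> C.
  by rewrite -addrA expi_2nat mulrDr mulr1 expiD expi_pi mulN1r.
case: (ord3P 0 k) => ->; rewrite ?add0r.
- rewrite a0 b0 epiXm // E0 rho_1Bexpi // subKr.
  have -> : e (s - 1) = e (2 * q%:R + 1 + s) * e (- (2 * q.+1%:R)).
    by rewrite -epiD -(natr1 q); congr e; ring.
  by move: (e _) (e _) (rc _) (rc _) => *; ring.
- rewrite a1 b1 epiXm // E0 opprK rho_1Dexpi // /face_twist.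
  have E : e (1 - 2 * b%:R) * e s = e (2 * q%:R + 1 + s) * e (- (2 * (b + q)%:R)).
    by rewrite -!epiD natrD; congr e; ring.
  rewrite mulrCA E.
  by move: (e _) (e _) (rc _) (rc _) => *; ring.
- rewrite a2 b2.
  by move: (e _) (e _) (rc _) => *; ring.
Qed.

End Edges.

(** * Circuits *)

Section Circuits.
Variables m N : nat.
Hypothesis m0 : (0 < m)%N.
Local Notation V := ('I_2 * 'I_m)%type.
Local Notation adj := (@complete_multipartite 2 m).
Implicit Types (b i j k q : nat) (o : bool).

Definition vtx o i : V := (if o then 1 else 0, Ordinal (ltn_pmod i m0)).

Lemma vtx_mod o i i' : i = i' %[mod m] -> vtx o i = vtx o i'.
Proof. by move=> h; congr (_, _); apply: val_inj. Qed.

Lemma vtx_eq o i o' i' : (vtx o i == vtx o' i') = (o == o') && (i == i' %[mod m]).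
Proof. by rewrite xpair_eqE -val_eqE /=; case: o o' => -[]. Qed.

Lemma vtxP (u : V) : exists o i, (i < m)%N /\ u = vtx o i.
Proof.
case: u => -[[|[|//]] h] i; [exists false, i | exists true, i];
  by split=> //; congr (_, _); apply: val_inj => //=; rewrite modn_small.
Qed.

Lemma adj_vtx o i o' i' : adj (vtx o i) (vtx o' i') = (o != o').
Proof. by case: o o' => -[]. Qed.

(** Corner 2q of face [b] is vertex q of part 0 and corner 2q+1 is vertex q+b of part 1. The edge
    from i to j is therefore on the faces b = j-i and b = j-i+1 modulo m. *)
Definition face_vtx b k : V := vtx (odd k) (k./2 + (if odd k then b else 0)).

Lemma face_vtx_even b q : face_vtx b q.*2 = vtx false q.
Proof. by rewrite /face_vtx odd_double doubleK addn0. Qed.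

Lemma face_vtx_odd b q : face_vtx b q.*2.+1 = vtx true (q + b).
Proof. by rewrite /face_vtx /= odd_double uphalf_double. Qed.

Definition face_circuit b : seq V := mkseq (face_vtx b) (2 * m).

Lemma steps_face_circuit b : steps (face_circuit b) =
  mkseq (fun k => (face_vtx b k, face_vtx b k.+1)) (2 * m).
Proof.
have [n hn] : exists n, (2 * m = n.+1)%N by exists (2 * m).-1; lia.
(* The walk closes up after 2m steps because index m is index 0 modulo m. *)
have h0 : face_vtx b 0 = face_vtx b n.+1.
  rewrite -hn mul2n face_vtx_even -[X in face_vtx b X = _]double0 face_vtx_even.
  by apply: vtx_mod; rewrite modnn mod0n.
rewrite /steps /face_circuit hn.
have -> : rot 1 (mkseq (face_vtx b) n.+1) = mkseq (fun k => face_vtx b k.+1) n.+1.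
  rewrite [RHS]mkseqS -h0 /mkseq /= rot1_cons; congr (rcons _ _).
  by rewrite (iotaDl 1 0) -map_comp.
rewrite /mkseq; elim: (iota 0 n.+1) => //= k s -> //.
Qed.

Lemma onth_steps b k u v : onth (steps (face_circuit b)) k = Some (u, v) ->
  u = face_vtx b k /\ v = face_vtx b k.+1.
Proof.
rewrite steps_face_circuit; have [lt|ge] := ltnP k (2 * m).
  by move=> /(onth_nth (u, v)); rewrite nth_mkseq // => -[<- <-].
by rewrite onth_default // size_mkseq.
Qed.

Lemma size_walk_edges b : size (walk_edges (face_circuit b)) = (2 * m)%N.
Proof. by rewrite /walk_edges size_map steps_face_circuit size_mkseq. Qed.

Lemma cycle_face_circuit b : cycle adj (face_circuit b).
Proof.
have h k : adj (face_vtx b k) (face_vtx b k.+1).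
  by rewrite /face_vtx adj_vtx /=; case: (odd k).
suff : forall c : seq V, all (fun a => adj a.1 a.2) (steps c) -> cycle adj c.
  apply; rewrite steps_face_circuit; apply/allP => a /mapP[k _ ->]; exact: h.
case=> [|x s] //; rewrite /steps rot1_cons /=.
suff : forall y x0, all (fun a : V * V => adj a.1 a.2) (zip (y :: s) (rcons s x0)) ->
    path adj y (rcons s x0) by apply.
elim: s => [|z s IH] y x0 /=; first by rewrite !andbT.
by move=> /andP[-> /IH].
Qed.

Lemma mem_even_edge b q : (q < m)%N ->
  [set vtx false q; vtx true (q + b)]%SET \in walk_edges (face_circuit b).
Proof.
move=> hq; rewrite /walk_edges steps_face_circuit /mkseq -map_comp.
apply/mapP; exists q.*2; rewrite ?mem_iota /= ?add0n; first by lia.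
by rewrite face_vtx_even face_vtx_odd.
Qed.

Lemma mem_odd_edge b q : (q < m)%N ->
  [set vtx false q.+1; vtx true (q + b)]%SET \in walk_edges (face_circuit b).
Proof.
move=> hq; rewrite /walk_edges steps_face_circuit /mkseq -map_comp.
apply/mapP; exists q.*2.+1; rewrite ?mem_iota /= ?add0n; first by lia.
by rewrite -doubleS face_vtx_even face_vtx_odd finset.setUC.
Qed.

Hypothesis mN : m = (2 * N)%N.

Definition circuits (p : bool) : seq (seq V) :=
  [seq face_circuit (2 * t + p) | t <- iota 0 N].

Lemma mem_circuits (p : bool) b : (b < m)%N -> odd b = p ->
  face_circuit b \in circuits p.
Proof.
move=> hb hp; apply/mapP; exists b./2; first by rewrite mem_iota /=; lia.
by rewrite -hp mul2n addnC odd_double_half.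
Qed.

Lemma circuitsP (p : bool) c : c \in circuits p ->
  exists b, [/\ (b < m)%N, odd b = p & c = face_circuit b].
Proof.
move=> /mapP[t]; rewrite mem_iota /= => ht ->; exists (2 * t + p)%N.
by split=> //; [case: p; lia | rewrite oddD mul2n odd_double; case: p].
Qed.

Lemma edge_vtxP (E : {set V}) : E \in edge_set adj ->
  exists i j, [/\ (i < m)%N, (j < m)%N & E = [set vtx false i; vtx true j]%SET].
Proof.
move=> /imsetP[[u v]]; rewrite inE /=.
have [a [i [hi ->]]] := vtxP u; have [a' [j [hj ->]]] := vtxP v.
rewrite adj_vtx; case: a a' => -[] //= _ ->.
  by exists j, i; rewrite finset.setUC.
by exists i, j.
Qed.

(** With d = j - i modulo m, the edge is the even step q = i of face d and the odd step q = i - 1 of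
    face d + 1; exactly one of the two indices has the required parity. *)
Lemma edge_in_circuits (p : bool) i j : (i < m)%N -> (j < m)%N ->
  exists2 c, c \in circuits p & [set vtx false i; vtx true j]%SET \in walk_edges c.
Proof.
move=> hi hj; pose d := ((j + (m - i)) %% m)%N.
have hd : (d < m)%N by rewrite ltn_pmod.
have E : i + d = j %[mod m].
  by rewrite /d modnDmr addnCA subnKC ?modnDr // ltnW.
have [dp|dp] := eqVneq (odd d) p.
  exists (face_circuit d); first exact: mem_circuits.
  by rewrite -(vtx_mod true E); exact: mem_even_edge.
(* Evenness of m is what makes the parity of d + 1 survive the wrap from m to 0. *)
have mE : odd m = false by rewrite mN mul2n odd_double.
pose b := (d.+1 %% m)%N; have hb : (b < m)%N by rewrite ltn_pmod.
have bp : odd b = p.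
  have : odd b = odd d.+1.
    by rewrite (divn_eq d.+1 m) oddD oddM mE andbF.
  by rewrite /= => ->; case: (odd d) p dp => -[].
exists (face_circuit b); first exact: mem_circuits.
pose q := ((i + m.-1) %% m)%N; have hq : (q < m)%N by rewrite ltn_pmod.
have -> : vtx false i = vtx false q.+1.
  apply: vtx_mod; rewrite -addn1 /q modnDml -addnA addn1 prednK // modnDr //.
have -> : vtx true j = vtx true (q + b).
  apply: vtx_mod; rewrite -E /q /b modnDm addnAC -addnA -(addn1 d).
  by rewrite -addnA add1n prednK // addnA modnDr.
exact: mem_odd_edge.
Qed.

Lemma card_edges : #|edge_set adj| = (m * m)%N.
Proof.
pose f (x : 'I_m * 'I_m) : {set V} := [set vtx false x.1; vtx true x.2]%SET.
have -> : edge_set adj = (f @: finset.setT)%SET.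
  apply/setP => E; apply/idP/imsetP => [/edge_vtxP[i [j [hi hj ->]]]|[[i j] _ ->]].
    by exists (Ordinal hi, Ordinal hj).
  by apply/imsetP; exists (vtx false i, vtx true j); rewrite ?inE ?adj_vtx.
rewrite card_imset ?cardsT ?card_prod ?card_ord // => -[i j] [i' j'] E.
have : vtx false i \in f (i', j') by rewrite -E !inE eqxx.
have : vtx true j \in f (i', j') by rewrite -E !inE eqxx orbT.
rewrite !inE !vtx_eq /= !orbF !modn_small // => /eqP h1 /eqP h2.
by congr (_, _); exact: val_inj.
Qed.

(** A counting argument: N circuits of 2m steps list m^2 edges in all, and every one of the m^2
    edges of the graph occurs, so none is repeated. *)
Lemma circuits_decomposition p : circuit_decomposition adj (circuits p).
Proof.
set s := flatten [seq walk_edges c | c <- circuits p].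
have ss : size s = (m * m)%N.
  rewrite size_flatten /shape -map_comp /circuits -map_comp sumnE big_map.
  rewrite (eq_bigr (fun=> (2 * m)%N)) => [|t _]; last by rewrite /= size_walk_edges.
  by rewrite big_const_seq count_predT size_iota iter_addn_0; lia.
have sub : {subset enum (edge_set adj) <= s}.
  move=> E; rewrite mem_enum => /edge_vtxP[i [j [hi hj ->]]].
  have [c cD cE] := edge_in_circuits p hi hj.
  by apply/flattenP; exists (walk_edges c) => //; exact: map_f.
have sz : (size s <= size (enum (edge_set adj)))%N by rewrite ss -cardE card_edges.
have us : uniq s := leq_size_uniq (enum_uniq _) sub sz.
split; last first.
  apply: uniq_perm => [//||E]; first exact: enum_uniq.
  by have [_ ->] := uniq_min_size (enum_uniq _) sub sz.
apply/allP => c cD; have [b [hb _ ec]] := circuitsP cD.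
apply/and3P; split.
- by rewrite ec -size_eq0 size_mkseq; lia.
- by rewrite ec; exact: cycle_face_circuit.
- move: us; rewrite /s; elim: (circuits p) cD => //= c' D IH.
  rewrite inE cat_uniq => /predU1P[->|cD] /and3P[h1 _ h3]; first exact: h1.
  exact: IH.
Qed.

End Circuits.

(** * The embedding *)

Section Surface.
Variables (R : realType) (N : nat).
Hypothesis N1 : (1 < N)%N.
Local Notation C := (Cx R).
Local Notation m := (2 * N)%N.
Hypothesis m0 : (0 < m)%N.
Local Notation pt := (pt m0).
Local Notation e := (@epi R N).
Local Notation S := (fermat R m).
Local Notation V := ('I_2 * 'I_m)%type.
Local Notation adj := (@complete_multipartite 2 m).
Local Notation vtx := (vtx m0).
Local Notation F := (@face_set R N).
Implicit Types (b i j k : nat) (s t : R).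

Let N0 : (0 < N)%N := ltnW N1.

Lemma connected_star (A : set (R * R)) : A (0, 0) ->
  (forall p t, A p -> 0 <= t <= 1 -> A (t * p.1, t * p.2)) -> connected A.
Proof.
move=> A0 hA.
pose f (p : R * R) (t : R) := (t * p.1, t * p.2).
have -> : A = \bigcup_(p in A) (f p @` `[0, 1]).
  apply/seteqP; split=> [p Ap|_ [p Ap [t ht <-]]].
    exists p => //; exists 1; first by rewrite /= in_itv /= ler01 lexx.
    by rewrite /f !mul1r; case: p {Ap}.
  by apply: hA; move: ht; rewrite ?in_itv.
apply: bigcup_connected.
  exists (0, 0) => p Ap; exists 0; first by rewrite /= in_itv /= ler01 lexx.
  by rewrite /f !mul0r.
move=> p Ap; apply: connected_continuous_connected; first exact: segment_connected.
apply: continuous_subspaceT => t.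
apply: cts_pair.
  by apply: (@ctsM R); [exact: cts_id | exact: cts_cst].
by apply: (@ctsM R); [exact: cts_id | exact: cts_cst].
Qed.

Lemma nm_scale (p : R * R) t : 0 <= t -> nm (toC (t * p.1, t * p.2)) = t * nm (toC p).
Proof.
move=> t0; have -> : toC (t * p.1, t * p.2) = rc t * toC p.
  by apply: eqC; rewrite !cE /=; ring.
by rewrite nmM nm_rc ger0_norm.
Qed.

Lemma closed_discP (p : R * R) : @closed_disc R p <-> nm (toC p) <= 1.
Proof.
have E : nm (toC p) ^+ 2 = p.1 ^+ 2 + p.2 ^+ 2 := nm2 (toC p).
by rewrite /closed_disc /= -E expr_le1 ?nm_ge0.
Qed.

Lemma open_disc_connected : connected (@open_disc R).
Proof.
apply: connected_star; first by apply/open_discE; rewrite nm0.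
move=> p t /open_discE hp /andP[t0 t1]; apply/open_discE; rewrite nm_scale //.
by apply: le_lt_trans hp; rewrite ler_piMl // nm_ge0.
Qed.

Lemma closed_disc_connected : connected (@closed_disc R).
Proof.
apply: connected_star; first by apply/closed_discP; rewrite nm0.
move=> p t /closed_discP hp /andP[t0 t1]; apply/closed_discP; rewrite nm_scale //.
by apply: le_trans hp; rewrite ler_piMl // nm_ge0.
Qed.

Lemma closed_disc_compact : compact (@closed_disc R).
Proof.
apply: (subclosed_compact _
  (compact_setX (@segment_compact R (-1) 1) (@segment_compact R (-1) 1))).
  have -> : @closed_disc R = (fun p => nm (toC p)) @^-1` [set x | x <= 1].
    by apply/seteqP; split=> p /closed_discP.
  apply: closed_comp; last exact: closed_le.
  move=> p _; apply: (cts_comp (f := @nm R)); last exact: nm_continuous.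
  exact: toC_continuous.
move=> p /closed_discP hp; split; rewrite /= in_itv /= -ler_norml.
  exact: le_trans (re_le_nm (toC p)) hp.
exact: le_trans (im_le_nm (toC p)) hp.
Qed.

(** * The graph on the curve *)

Lemma epi_mod i : e (- (2 * i%:R)) = e (- (2 * (i %% m)%:R)).
Proof.
rewrite {1}(divn_eq i m) natrD mulrDr opprD epiD.
have -> : - (2 * (i %/ m * m)%:R) = m%:R * - (2 * (i %/ m)%:R) :> R.
  by rewrite (natrM _ (i %/ m)); ring.
by rewrite -epiX epiN2m // mul1r.
Qed.

Lemma edge_vec_mod i j i' j' s : i = i' %[mod m] -> j = j' %[mod m] ->
  edge_vec N i j s = edge_vec N i' j' s.
Proof.
move=> hi hj.
by rewrite /edge_vec (epi_mod i) (epi_mod j) hi hj -(epi_mod i') -(epi_mod j').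
Qed.

(** Defined on all of R^V by sums over the parts, which makes continuity immediate. On a point of
    the realization at most one barycentric coordinate per part is nonzero, and [alpha] vanishes at
    0, so each sum reduces to the corresponding coordinate of [edge_vec]. *)
Definition graph_vec (w : V -> R) : 'I_3 -> C := vec3
  (\sum_(i < m) e (- (2 * i%:R)) * rc (alpha N (w (0, i))))
  (\sum_(j < m) e (- (2 * j%:R)) * rc (alpha N (w (1, j)))) (e 1).

Definition graph_map (w : {ptws V -> R}) : S := pt (graph_vec w).

Lemma segment_pointC (u v : V) s : segment_point u v s = segment_point v u (1 - s).
Proof. by apply: funext => w; rewrite /segment_point subKr addrC. Qed.

Lemma graph_vec_edge i j s :
  graph_vec (segment_point (vtx false i) (vtx true j) s) = edge_vec N i j s.
Proof.
have w0 (k : 'I_m) : segment_point (vtx false i) (vtx true j) s (0, k) =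
    if k == Ordinal (ltn_pmod i m0) then 1 - s else 0.
  rewrite /segment_point /vtx !xpair_eqE eqxx /=.
  by case: eqP => _; rewrite ?mulr1 ?mulr0 addr0.
have w1 (k : 'I_m) : segment_point (vtx false i) (vtx true j) s (1, k) =
    if k == Ordinal (ltn_pmod j m0) then s else 0.
  rewrite /segment_point /vtx !xpair_eqE eqxx /=.
  by case: eqP => _; rewrite ?mulr1 ?mulr0 add0r.
rewrite /graph_vec /edge_vec; congr vec3.
  rewrite [in RHS]epi_mod (bigD1 (Ordinal (ltn_pmod i m0))) //= w0 eqxx big1 ?addr0 //.
  by move=> k /negPf kn; rewrite w0 kn alpha0 // rmorph0 mulr0.
rewrite [in RHS]epi_mod (bigD1 (Ordinal (ltn_pmod j m0))) //= w1 eqxx big1 ?addr0 //.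
by move=> k /negPf kn; rewrite w1 kn alpha0 // rmorph0 mulr0.
Qed.

Lemma graph_map_edge i j s :
  graph_map (segment_point (vtx false i) (vtx true j) s) = pt (edge_vec N i j s).
Proof. by rewrite /graph_map graph_vec_edge. Qed.

Lemma segment_edge (u v : V) s : 0 <= s <= 1 -> adj u v -> exists i j t,
  [/\ (i < m)%N, (j < m)%N, 0 <= t <= 1, t = s \/ t = 1 - s &
    segment_point u v s = segment_point (vtx false i) (vtx true j) t].
Proof.
move=> hs; have [a [i [hi ->]]] := vtxP m0 u; have [a' [j [hj ->]]] := vtxP m0 v.
rewrite adj_vtx; case: a a' => -[] // _.
  exists j, i, (1 - s); rewrite -segment_pointC; split=> //; last by right.
  by move: hs => /andP[h1 h2]; apply/andP; split; lra.
by exists i, j, s; split=> //; left.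
Qed.

Lemma realization_edge (w : {ptws V -> R}) : realization adj w ->
  exists i j s, [/\ (i < m)%N, (j < m)%N, 0 <= s <= 1 &
    w = segment_point (vtx false i) (vtx true j) s].
Proof.
move=> [u [v [uv [s]]]]; rewrite /= in_itv /= => hs <-.
case/orP: uv => [/eqP <-|uv]; last first.
  by have [i [j [t [hi hj ht _ ->]]]] := segment_edge hs uv; exists i, j, t.
(* A degenerate segment is an end of any segment starting at [u]; vertex 0 of the other part is
   chosen for its second end. *)
have E u' : segment_point u u s = segment_point u u' 0.
  apply: funext => x; rewrite /segment_point; ring.
have [a [i [hi ua]]] := vtxP m0 u; case: a ua => ua.
  exists 0%N, i, 1; rewrite ler01 lexx; split=> //.
  by rewrite (E (vtx false 0)) ua [RHS]segment_pointC subrr.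
exists i, 0%N, 0; rewrite ler01 lexx; split=> //.
by rewrite (E (vtx true 0)) ua.
Qed.

Lemma edge_realization i j s : 0 <= s <= 1 ->
  realization adj (segment_point (vtx false i) (vtx true j) s).
Proof.
move=> hs; exists (vtx false i), (vtx true j); rewrite adj_vtx orbT; split=> //.
by exists s => //; rewrite /= in_itv.
Qed.

Lemma graph_embedding : embedding adj graph_map.
Proof.
split.
  apply: (@within_pt R m m0 {ptws V -> R} (realization adj) graph_vec).
    move=> w /realization_edge[i [j [s [_ _ _ ->]]]].
    by rewrite graph_vec_edge; exact: edge_vec_on.
  have ca (x : V) w : continuous_at w (fun w : {ptws V -> R} => rc (alpha N (w x))).
    apply: (cts_comp (f := @rc R)); last exact: rc_continuous.
    apply: (cts_comp (f := alpha N)); last exact: alpha_continuous.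
    exact: proj_continuous.
  move=> w _; apply: vec3_cts; last exact: cts_cst.
    by apply: cts_sum => i; apply: ctsM; [exact: cts_cst | exact: ca].
  by apply: cts_sum => i; apply: ctsM; [exact: cts_cst | exact: ca].
move=> x y /realization_edge[i [j [s [hi hj hs ->]]]].
move=> /realization_edge[i' [j' [s' [hi' hj' hs' ->]]]].
rewrite !graph_map_edge => /(pt_edge_inj N0 hi hj hi' hj' hs hs')[<- Ei Ej].
(* At an end of the edge one index stays undetermined, but there its barycentric coordinate is 0. *)
have [s1|s1] := eqVneq s 1.
  have -> : j = j' by apply: Ej; rewrite s1 oner_neq0.
  by apply: funext => w; rewrite /segment_point s1 subrr !mul0r.
have [s0|s0] := eqVneq s 0.
  by rewrite (Ei s1); apply: funext => w; rewrite /segment_point s0 !mul0r.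
by rewrite (Ei s1) (Ej s0).
Qed.

(** * The faces as connected components *)

Local Notation G := (graph_map @` realization adj).

Lemma face_compl b : F b `<=` ~` G.
Proof.
move=> p Fp [w /realization_edge[i [j [s [_ _ _ ->]]]]].
rewrite graph_map_edge => E; move: Fp; rewrite -E.
exact: edge_not_face.
Qed.

Lemma compl_face p : (~` G) p -> exists2 b, (b < m)%N & F b p.
Proof.
move=> Gp; have [//|[i [j [s [_ _ hs E]]]]] := face_or_edge N0 m0 p.
case: Gp; exists (segment_point (vtx false i) (vtx true j) s).
  exact: edge_realization.
by rewrite graph_map_edge E.
Qed.

Lemma face_open b : open (F b).
Proof.
rewrite openE => p [h1 h2].
have n1 := near_nz h1.
have c : continuous_at p (fun q => coord 0 1 q * face_twist R N b).
  by apply: ctsM; [exact: coord_cts | exact: cts_cst].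
have n2 : \forall q \near p, sector N (coord 0 1 q * face_twist R N b).
  apply: (cts_near c); apply: open_nbhs_nbhs; split; last exact: h2.
  exact: sector_open.
near=> q; split; first by near: q.
by near: q.
Unshelve. all: by end_near.
Qed.

Lemma face_connected b : connected (F b).
Proof.
have [<- _ hc _] := face_homeo R N0 m0 b.
by apply: connected_continuous_connected; [exact: open_disc_connected | exact: hc].
Qed.

Lemma face_nonempty b : F b (face_map m0 b (0, 0)).
Proof.
have [<- _ _ _] := face_homeo R N0 m0 b.
by exists (0, 0) => //; apply/open_discE; rewrite nm0.
Qed.

(** The sets [F b] are open, connected and disjoint, and they cover the complement of the graph.
    Each is thus relatively clopen there, its complement being the union of the others. *)
Lemma face_component b p : (b < m)%N -> F b p ->
  connected_component (~` G) p = F b.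
Proof.
move=> hb Fp; apply/seteqP; split; last first.
  apply: connected_component_max => //; first exact: face_compl.
  exact: face_connected.
set K := connected_component _ _.
have KG : K `<=` ~` G by exact: connected_component_sub.
have Kp : K p by apply: connected_component_refl; exact: face_compl Fp.
suff <- : K `&` F b = K by move=> q [].
apply: (@component_connected _ (~` G) p).
- by exists p.
- by exists (F b) => //; exact: face_open.
exists (~` \bigcup_(b' in [set b' | (b' < m)%N /\ b' <> b]) F b').
  by apply: open_closedC; apply: bigcup_open => b' _; exact: face_open.
apply/seteqP; split=> q [Kq].
  move=> Fq; split=> // -[b' [hb' nb] Fq'].
  by apply: nb; exact: (face_set_inj N0 m0 hb' hb Fq' Fq).
move=> nFq; split=> //; have [b' hb' Fq] := compl_face (KG _ Kq).
have [<- //|/eqP nb] := eqVneq b' b.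
by case: nFq; exists b'.
Qed.

Lemma faceP (A : set S) : face adj graph_map A <-> exists2 b, (b < m)%N & A = F b.
Proof.
split=> [[p [Gp ->]]|[b hb ->]].
  by have [b hb Fp] := compl_face Gp; exists b => //; exact: face_component.
have h := face_nonempty b.
exists (face_map m0 b (0, 0)); split; first exact: face_compl h.
by rewrite (face_component hb h).
Qed.

Lemma face_bounded b : bounded_by graph_map (F b) (face_circuit m0 b).
Proof.
exists (face_map m0 b), (face_inv b); split.
- exact: face_map_cts.
- exact: face_homeo.
move=> k u v s h hs; have [-> ->] := onth_steps h.
have -> : face_map m0 b
    (polar (0, 0) 1 (2 * pi * (k%:R + s) / (size (face_circuit m0 b))%:R)) =
    pt (face_vec N b (e (k%:R + s))).
  rewrite /face_map toC_polar size_mkseq; congr (pt (face_vec N b _)).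
  have -> : toC (0, 0) = 0 :> C by [].
  rewrite add0r rmorph1 mul1r /epi; congr expi.
  by rewrite (natrM _ 2 m); field; rewrite pnatr_eq0 -lt0n.
(* The angle is now that of [e (k + s)]; even k gives an edge run through from part 0, odd k one run
   through from part 1. *)
rewrite -(odd_double_half k); case: (odd k); rewrite ?add1n ?add0n.
  rewrite face_vtx_odd -doubleS face_vtx_even segment_pointC graph_map_edge.
  rewrite [(k./2 + b)%N]addnC -face_boundary_odd //; congr (pt (face_vec N b (e _))).
  by rewrite -natr1 -mul2n natrM.
rewrite face_vtx_odd face_vtx_even graph_map_edge [(k./2 + b)%N]addnC.
by rewrite -face_boundary_even // -mul2n natrM.
Qed.

(** For N >= 2 the half-angle is at most pi/4. The resulting inequality is closed and does not
    mention [arg], and its only solution with real part 0 is 0; this keeps nonzero limits of the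
    sector inside the domain where [arg] is continuous. *)
Lemma sector_im (z : C) : sector N z -> `|im z| <= re z.
Proof.
move=> [z0 hz]; have hp := pi_gt0 R.
have h4 : pi / 2 / N%:R <= pi / 4 :> R.
  rewrite -[X in _ <= X / _]mulr1 (_ : pi * 1 / 4 = pi / 2 / 2 :> R); last by field.
  rewrite ler_pM2l ?divr_gt0 // lef_pV2 ?posrE ?ltr0n //; by rewrite ler_nat.
have : `|im z / re z| <= 1.
  rewrite leNgt; apply/negP => h.
  have : pi / 4 < `|arg z|.
    have := lt_atan h; rewrite atan1 /arg => h'; apply: lt_le_trans h' _.
    have [h0|h0] := leP 0 (im z / re z).
      by rewrite (ger0_norm h0) ler_norm.
    by rewrite (ltr0_norm h0) atanN -normrN ler_norm.
  by rewrite ltNge (le_trans (ltW hz) h4).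
by rewrite normrM normfV (gtr0_norm z0) ler_pdivrMr // mul1r.
Qed.

Lemma closure_sector (z : C) : z != 0 -> closure (sector N) z ->
  0 < re z /\ `|arg z| <= pi / 2 / N%:R.
Proof.
move=> z0 hz.
have h1 : `|im z| <= re z.
  rewrite leNgt; apply/negP => h.
  have : \forall w \near z, 0 < `|im w| - re w.
    apply: near_gt0; last by rewrite subr_gt0.
    apply: ctsD; last by apply: ctsN; exact: re_continuous.
    apply: (cts_comp (f := fun x : R => `|x|)); last exact: norm_continuous.
    exact: im_continuous.
  by move=> /hz[w [/sector_im h2]]; rewrite /= subr_gt0 ltNge h2.
have h2 : 0 < re z.
  rewrite lt_def (le_trans _ h1) // andbT; apply/eqP => r0.
  move: h1; rewrite r0 normr_le0 => /eqP i0.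
  by move/eqP: z0; apply; apply: eqC; rewrite ?r0 ?i0.
split=> //; rewrite leNgt; apply/negP => h.
have : \forall w \near z, 0 < `|arg w| - pi / 2 / N%:R.
  apply: near_gt0; last by rewrite subr_gt0.
  apply: ctsD; last exact: cts_cst.
  apply: (cts_comp (f := fun x : R => `|x|)); last exact: norm_continuous.
  exact: arg_continuous.
by move=> /hz[w [[_ h3] ]]; rewrite /= subr_gt0 ltNge ltW.
Qed.

Lemma epi_arg r : 0 < re (e r) -> `|arg (e r)| <= pi / 2 / N%:R ->
  exists2 t, `|t| <= 1 & e r = e t.
Proof.
move=> h1 h2; have hp := pi_gt0 R; have NR : 0 < N%:R :> R by rewrite ltr0n.
exists (arg (e r) * m%:R / pi).
  rewrite 2!normrM normfV (gtr0_norm hp) (ger0_norm (ler0n _ _)) ler_pdivrMr // mul1r.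
  rewrite -ler_pdivlMr ?ltr0n //; apply: le_trans h2 _.
  by rewrite natrM invfM mulrA.
have E : e r = expi (arg (e r)) by rewrite {1}(polar_arg h1) nm_expi rmorph1 mul1r.
have mR : m%:R != 0 :> R by rewrite pnatr_eq0 -lt0n.
rewrite {1}E; move: (arg (e r)) => a; rewrite /epi; congr expi.
move: (m%:R) mR => x x0.
by rewrite [pi * _]mulrC divfK ?gt_eqF // mulfK.
Qed.

(** At the midpoint of an edge x and y have the same modulus, so x/y times the twist is a point of
    the unit circle. In the closure of the face its argument is at most pi/2N in absolute value,
    which is the range of [e] on [-1, 1]. *)
Lemma closure_face b i j : closure (F b) (pt (edge_vec N i j (1 / 2))) ->
  exists2 t, `|t| <= 1 &
    e (2 * j%:R - 2 * i%:R + (1 - 2 * b%:R)) = e t.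
Proof.
move=> hcl; set p := pt _ in hcl.
have on := edge_vec_on N0 m0 i j (1 / 2 : R).
have [a0 a1 _] := edge_vecE N i j (1 / 2 : R).
have ah : alpha N (1 / 2 : R) != 0.
  apply/eqP => h; have : (1 / 2 : R) = 0 by apply: (alpha_eq0 N0 _ h); lra.
  by lra.
have rah : rc (alpha N (1 / 2 : R)) != 0 by rewrite rc_eq0.
have n1 : nz 1 p by rewrite /p nz_pt // a1; apply: mulf_neq0; [exact: epi_neq0 | exact: rah].
have hz : coord 0 1 p * face_twist R N b = e (2 * j%:R - 2 * i%:R + (1 - 2 * b%:R)).
  rewrite (coord_pt _ _ _ on) a0 a1 /face_twist.
  have -> : 1 - 1 / 2 = 1 / 2 :> R by lra.
  have -> : e (2 * j%:R - 2 * i%:R + (1 - 2 * b%:R)) =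
      e (- (2 * i%:R)) / e (- (2 * j%:R)) * e (1 - 2 * b%:R).
    by rewrite -epiN opprK -!epiD; congr e; ring.
  have := @epi_neq0 R N (- (2 * j%:R)).
  move: (rc _) rah (e _) (e _) (e _) => x x0 y z t z0.
  by field; rewrite x0 z0.
have cz : closure (sector N) (coord 0 1 p * face_twist R N b).
  move=> A hA.
  have c : continuous_at p (fun q => coord 0 1 q * face_twist R N b).
    by apply: ctsM; [exact: coord_cts | exact: cts_cst].
  have [q [[_ hq] Aq]] := hcl _ (c _ hA).
  by exists (coord 0 1 q * face_twist R N b).
have [] := closure_sector _ cz; first by rewrite hz epi_neq0.
by rewrite hz => h1 h2; exact: epi_arg.
Qed.

(** Subtracting the two conditions gives 2d = t - t' modulo 2m, where d = b' - b is even and |t -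
    t'| <= 2. Without wrapping around this forces d <= 1, so d = 0. *)
Lemma closure_face_parity b b' i j : (b < m)%N -> (b' < m)%N -> odd b = odd b' ->
  closure (F b) (pt (edge_vec N i j (1 / 2))) ->
  closure (F b') (pt (edge_vec N i j (1 / 2))) -> b = b'.
Proof.
wlog le_bb : b b' / (b <= b')%N.
  move=> H hb hb' o cb cb'; have [le|/ltnW le] := leqP b b'; first exact: H.
  by apply/esym; apply: H.
move=> hb hb' o /closure_face[t ht Et] /closure_face[t' ht' Et'].
pose d := (b' - b)%N.
have dodd : odd d = false by rewrite oddB // o addbb.
(* Here m is even too. With d = m - 1 the number 2d - (t - t') could reach 2m: this is the true
   adjacency of the faces 0 and m - 1. *)
have hd : (d <= m - 2)%N.
  have : (d < m)%N by rewrite (leq_ltn_trans (leq_subr _ _)).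
  by have := odd_double_half d; rewrite dodd; lia.
have b'E : b'%:R = b%:R + d%:R :> R by rewrite -natrD subnKC.
have E : e (2 * d%:R - (t - t')) = 1.
  have -> : 2 * d%:R - (t - t') = (2 * j%:R - 2 * i%:R + (1 - 2 * b%:R)) - t
     - ((2 * j%:R - 2 * i%:R + (1 - 2 * b'%:R)) - t').
    by rewrite b'E; ring.
  move: (_ + (1 - 2 * b%:R)) (_ + (1 - 2 * b'%:R)) Et Et' => x x' hx hx'.
  have ex : e (x - t) = 1 by rewrite epiD hx -epiD subrr epi_0.
  have ex' : e (x' - t') = 1 by rewrite epiD hx' -epiD subrr epi_0.
  by rewrite epiD epiN ex ex' invr1 mulr1.
have dR : d%:R <= m%:R - 2 :> R.
  by rewrite -[2]/(2%:R) -natrB ?ler_nat //; lia.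
have d0 : 0 <= d%:R :> R by rewrite ler0n.
move: ht ht'; rewrite !ler_norml => /andP[t1 t2] /andP[t3 t4].
have : 2 * d%:R - (t - t') = 0.
  by apply: (epi_eq1 m0) E; rewrite ltr_norml; apply/andP; split; lra.
move=> h; have : d%:R <= 1 :> R by lra.
rewrite -[1]/(1%:R) ler_nat => hd1.
have dz : d = 0%N by move: dodd hd1; case: (d) => [|[|]].
by apply/eqP; rewrite eqn_leq le_bb -subn_eq0 -/d dz.
Qed.

(** * The face coloring *)

Definition even_face (A : set S) : bool :=
  `[< exists b, [/\ (b < m)%N, ~~ odd b & A = F b] >].

Lemma even_faceE b : (b < m)%N -> even_face (F b) = ~~ odd b.
Proof.
move=> hb; apply/asboolP/idP => [[b' [hb' ob' E]]|ob]; last by exists b.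
have h := face_nonempty b; have h' := h; rewrite E in h'.
by rewrite (face_set_inj N0 m0 hb hb' h h').
Qed.

Lemma graph_biembedding : biembedding adj graph_map.
Proof.
(* Color [true] marks even indices, whose circuits form the list of parity [false]. *)
exists (circuits N m0 false), (circuits N m0 true); split.
- exact: circuits_decomposition.
- exact: circuits_decomposition.
split; first exact: graph_embedding.
exists even_face; split.
- move=> _ _ u v /faceP[b hb ->] /faceP[b' hb' ->] nbb uv hcl.
  rewrite !even_faceE //; apply/negP => /eqP/negb_inj o; apply: nbb; congr face_set.
  have h2 : 0 <= (1 / 2 : R) <= 1 by lra.
  have [i [j [s [_ _ _ hs E]]]] := segment_edge h2 uv.
  have s2 : s = 1 / 2 by case: hs => ->; lra.
  have [] : (closure (F b) `&` closure (F b')) (pt (edge_vec N i j (1 / 2))).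
    apply: hcl; exists (segment_point u v (1 / 2)); first by exists (1 / 2); rewrite //= in_itv.
    by rewrite E s2 graph_map_edge.
  exact: closure_face_parity.
- split=> [_ /faceP[b hb ->]|_ /(circuitsP (erefl m))[b [hb ob ->]]].
    rewrite even_faceE // => /negPf ob; exists (face_circuit m0 b); split.
      exact: mem_circuits.
    exact: face_bounded.
  exists (F b); split; [|by rewrite even_faceE // ob | exact: face_bounded].
  by apply/faceP; exists b.
- split=> [_ /faceP[b hb ->]|_ /(circuitsP (erefl m))[b [hb ob ->]]].
    rewrite even_faceE // => /negbFE ob; exists (face_circuit m0 b); split.
      exact: mem_circuits.
    exact: face_bounded.
  exists (F b); split; [|by rewrite even_faceE // ob | exact: face_bounded].
  by apply/faceP; exists b.
Qed.

Lemma face_circuit_circuit b : (b < m)%N -> circuit adj (face_circuit m0 b).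
Proof.
move=> hb; have [/allP h _] := circuits_decomposition m0 (erefl m) (odd b).
by apply: h; exact: mem_circuits.
Qed.

Lemma graph_face_length (A : set S) : face adj graph_map A ->
  face_length adj graph_map A (2 * m).
Proof.
move=> /faceP[b hb ->]; exists (face_circuit m0 b); split.
- exact: face_circuit_circuit.
- exact: face_bounded.
- exact: size_mkseq.
Qed.

Lemma graph_cellular : cellular adj graph_map.
Proof.
move=> _ /faceP[b _ ->]; exists (face_inv b), (face_map m0 b).
by apply: homeomorphism_sym; exact: face_homeo.
Qed.

(** * Compactness and connectedness of the curve *)

Local Notation K b := (face_map m0 b @` @closed_disc R).

Lemma closed_faces_cover : [set: S] = \bigcup_(b in `I_m) K b.
Proof.
apply/seteqP; split=> // p _.
have [[b hb]|[i [j [s [hi hj hs ->]]]]] := face_or_edge N0 m0 p.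
  have [<- _ _ _] := face_homeo R N0 m0 b; move=> [x /open_discE hx <-].
  by exists b => //; exists x => //; apply/closed_discP; exact: ltW.
(* Of the two closed faces containing the edge, the one of index j - i is taken; the edge is its
   even step starting at 2i. *)
exists ((j + (m - i)) %% m)%N; first by rewrite /= ltn_pmod.
exists (ofC (e (2 * i%:R + s))).
  by apply/closed_discP; rewrite ofCK nm_expi.
rewrite /face_map ofCK face_boundary_even //; congr pt.
apply: edge_vec_mod => //.
by rewrite modnDml -addnA subnK ?modnDr // ltnW.
Qed.

Lemma fermat_compact : compact [set: S].
Proof.
rewrite closed_faces_cover bigcup_mkord.
suff h n : compact (\big[setU/set0]_(b < n) K b) by exact: h.
elim: n => [|n IH].
  by rewrite big_ord0; exact: compact0.
rewrite big_ord_recr /=; apply: compactU => //.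
by apply: continuous_compact; [exact: face_map_cts | exact: closed_disc_compact].
Qed.

Lemma fermat_connected : connected [set: S].
Proof.
rewrite closed_faces_cover; apply: bigcup_connected => [|b _]; last first.
  apply: connected_continuous_connected; first exact: closed_disc_connected.
  exact: face_map_cts.
(* At d = 1 the second coordinate [rho N (1 - d ^+ m)] vanishes and with it the twist, so all closed
   faces contain this vertex. *)
exists (face_map m0 0 (1, 0)) => b _; exists (1, 0).
  by rewrite /closed_disc /= expr1n expr0n addr0.
rewrite /face_map; congr pt; rewrite /face_vec.
have -> : toC (1, 0) = 1 :> C by [].
by rewrite !expr1n subrr rho0 // !mulr0.
Qed.

Lemma fermat_closed_surface : closed_surface R S.
Proof.
split.
- exact: fermat_hausdorff.
- exact: fermat_compact.
- exact: fermat_connected.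
- move=> p; have [i [w [hw hp]]] := fermat_chart_cover m0 p.
  exists (chart_dom i w), (@chart_cod R m), (@chart_map R m i), (chart_inv m0 i w).
  by split=> //; exact: fermat_chart.
Qed.

End Surface.

Local Close Scope ring_scope.
Local Close Scope classical_set_scope.

Theorem proposition5p10 (R : realType) (n : nat) (n_prime : prime n)
    (n_odd : odd n) :
  exists (S : topologicalType)
         (phi : {ptws ('I_2 * 'I_(2 * n ^ 2))%type -> R} -> S),
    [/\ closed_surface R S, orientable R S,
        cellular (@complete_multipartite 2 (2 * n ^ 2)) phi,
        biembedding (@complete_multipartite 2 (2 * n ^ 2)) phi &
        forall F : set S,
          face (@complete_multipartite 2 (2 * n ^ 2)) phi F ->
          [\/ face_length (@complete_multipartite 2 (2 * n ^ 2)) phi F (4 * n),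
              face_length (@complete_multipartite 2 (2 * n ^ 2)) phi F (4 * n ^ 2) |
              face_length (@complete_multipartite 2 (2 * n ^ 2)) phi F (4 * n ^ 3)]].

Proof.
have n2 : (1 < n ^ 2)%N.
  by rewrite -[X in (X < _)%N](exp1n 2) ltn_exp2r // prime_gt1.
have m0 : (0 < 2 * n ^ 2)%N by rewrite muln_gt0 /= ltnW.
exists (fermat R (2 * n ^ 2)), (graph_map m0); split.
- exact: fermat_closed_surface.
- exact: fermat_orientable.
- exact: graph_cellular.
- exact: graph_biembedding.
(* The length 2m with m = 2n^2 is the middle alternative. *)
- move=> F hF; constructor 2; rewrite -[4]/(2 * 2)%N -mulnA.
  exact: graph_face_length.
Qed.
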